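(* Let $X$ be a $0$-reduced simplicial set, let $\phi:\hat\Omega CX\to CGX$ be the Szczarba map and $\psi:CGX\to\hat\Omega CX$ the retraction map (both defined in the context). Then $\psi$ is a retraction of $\phi$, that is, the composite $\psi\phi$ is the identity of $\hat\Omega CX$.
   Context: A simplicial set $X$ is $0$-reduced if $X_0$ is a single point $*$. For $x\in X_n$ and a monotone map $f:\{0,\dots,m\}\to\{0,\dots,n\}$, $x_{(f(0),\dots,f(m))}\in X_m$ denotes the corresponding simplex. Normalised chains: $C_nX$ is the free abelian group on the nondegenerate $n$-simplices (degenerate simplices are identified with $0$), with $\partial=\sum(-1)^id_i$; $CGX$ is the normalised chain complex of the simplicial set underlying $GX$. Extended cobar construction $\hat\Omega CX$: the graded ring (product written $\otimes$) generated by symbols $s^{-1}x$ of degree $n-1$ for each nondegenerate $x\in X_n$, $n\ge1$, and $\xi_x$ of degree $0$ for each nondegenerate $x\in X_1$, subject only to the relations that $\xi_x$ is a two-sided inverse of $1+s^{-1}x$ for nondegenerate $x\in X_1$. Conventions: $s^{-1}y=0$ if $y$ is degenerate, and $\xi_{s_0*}=1$. The differential $\partial^\Omega$ is the derivation that is zero on degree $0$ elements and, for $x\in X_{n+1}$, $n\ge1$, is $$\partial^\Omega s^{-1}x=\sum_{r=0}^{n+1}(-1)^{r+1}s^{-1}d_rx+\sum_{r=1}^n(-1)^r s^{-1}x_{(0,\dots,r)}\otimes s^{-1}x_{(r,\dots,n+1)}.$$ Kan loop group: $GX$ is the simplicial group with $(GX)_n=\mathbf F(X_{n+1})/\mathbf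 F(s_0X_n)$ ($\mathbf F$ = free group); writing $\tau x\in (GX)_n$ for the class of $x\in X_{n+1}$ (so $\tau s_0x=1$), the simplicial structure is determined by $s_i\tau x=\tau s_{i+1}x$ for $i\ge0$, $d_0\tau x=(\tau d_0x)^{-1}\cdot\tau d_1x$, and $d_i\tau x=\tau d_{i+1}x$ for $i\ge1$. Multiplication on $CGX$: for $g\in (GX)_p$, $h\in (GX)_q$, $$m(g\otimes h)=\sum(-1)^{\mathrm{sgn}(\mu,\nu)}s_{\mu(q)}\cdots s_{\mu(1)}g\cdot s_{\nu(p)}\cdots s_{\nu(1)}h,$$ the sum being over all $(p,q)$-shuffles, i.e. partitions of $\{0,\dots,p+q-1\}$ into $\nu(1)<\dots<\nu(p)$ and $\mu(1)<\dots<\mu(q)$, with $\mathrm{sgn}(\mu,\nu)$ the parity of the permutation $(\nu(1),\dots,\nu(p),\mu(1),\dots,\mu(q))$. Szczarba operators: any simplicial operator has a normal form $\theta=s_{i_1}\cdots s_{i_q}d_{j_1}\cdots d_{j_r}$ with $i_k>i_{k+1}$, $j_k<j_{k+1}$; its derived operator is $\theta'=s_{i_1+1}\cdots s_{i_q+1}d_{j_1+1}\cdots d_{j_r+1}$. Let $S_n$ be the set of integer sequences $i=(i_1,\dots,i_n)$ with $0\le i_k\le n-k$, and $\sum i=i_1+\dots+i_n$. Operators $D^{n+1}_{j;i}:(GX)_{n-j}\to (GX)_n$, $i\in S_n$, $0\le j\le n$, are defined by $D^1_{0;()}=\mathrm{Id}$ and $$D^{n+1}_{j;i_1,\dots,i_n}=\begin{cases}(D^{n}_{j;i_2,\dots,i_n})'\,s_0\,d_{i_1-j}&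 j<i_1,\\ (D^{n}_{j;i_2,\dots,i_n})'& j=i_1,\\ (D^{n}_{j-1;i_2,\dots,i_n})'\,s_0& j>i_1.\end{cases}$$ For $x\in X_{n+1}$, $\mathrm{Sz}_i\,x=D^{n+1}_{0;i}(\tau x)^{-1}\cdot D^{n+1}_{1;i}(\tau d_0x)^{-1}\cdots D^{n+1}_{n;i}(\tau d_0^nx)^{-1}\in (GX)_n$. Szczarba map: $\phi:\hat\Omega CX\to CGX$ is the homomorphism of differential graded algebras determined by $\phi_0(\xi_x)=\tau x$ and $\phi_0(s^{-1}x)=(\tau x)^{-1}-1$ for $x\in X_1$, and $\phi_n(s^{-1}x)=\sum_{i\in S_n}(-1)^{\sum i}\,\mathrm{Sz}_i\,x$ for $x\in X_{n+1}$, $n\ge1$. Retraction map: $\psi:CGX\to\hat\Omega CX$ is the unique family of linear maps $\psi_n:C_nGX\to(\hat\Omega CX)_n$ with $\psi_0(1)=1$ and, for all $n\ge0$, $x\in X_{n+1}$, $g\in (GX)_n$, $$\psi_n(\tau x\cdot g)=\psi_n(g)-\sum_{i=0}^n s^{-1}x_{(0,\dots,i+1)}\otimes\psi_{n-i}(\tau d_1^ix\cdot d_0^ig).$$ *)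

(* Defs.v *)
From HB Require Import structures.
From mathcomp Require Import all_boot all_order perm all_algebra.
From mathcomp Require Import boolp.
From mathcomp Require Import freeg zify.

Set Implicit Arguments.
Unset Strict Implicit.
Unset Printing Implicit Defensive.

Import GRing.Theory.
Local Open Scope ring_scope.
Local Open Scope quotient_scope.

Record dmap (m n : nat) := DMap {
  dfun :> {ffun 'I_m.+1 -> 'I_n.+1};
  dfunP : [forall i : 'I_m.+1, forall j : 'I_m.+1, (i <= j) ==> (dfun i <= dfun j)]%N }.
HB.instance Definition _ m n := [isSub for @dfun m n].
HB.instance Definition _ m n := [Finite of dmap m n by <:].

Lemma dfun_le m n (f : dmap m n) (i j : 'I_m.+1) : (i <= j)%N -> (f i <= f j)%N.
Proof. by move: i j; have /'forall_forallP h := dfunP f => i j; apply/implyP/h. Qed.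

Lemma dmap_eq m n (f g : dmap m n) : (forall i, f i = g i :> nat) -> f = g.
Proof. by move=> h; apply/val_inj/ffunP => i; apply/val_inj/h. Qed.

Lemma did_subproof n :
  [forall i : 'I_n.+1, forall j : 'I_n.+1,
    (i <= j) ==> ([ffun k : 'I_n.+1 => k] i <= [ffun k : 'I_n.+1 => k] j)]%N.
Proof. by apply/'forall_forallP => i j; rewrite !ffunE implybb. Qed.
Definition did n : dmap n n := DMap (did_subproof n).

Lemma dcomp_subproof l m n (f : dmap m n) (g : dmap l m) :
  [forall i : 'I_l.+1, forall j : 'I_l.+1,
    (i <= j) ==> ([ffun k => f (g k)] i <= [ffun k => f (g k)] j)]%N.
Proof.
apply/'forall_forallP => i j; rewrite !ffunE; apply/implyP => ij.
by apply/dfun_le/dfun_le.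
Qed.
Definition dcomp l m n (f : dmap m n) (g : dmap l m) : dmap l n :=
  DMap (dcomp_subproof f g).

Record sset := SSet {
  simplex :> nat -> Type;
  sact : forall m n, dmap m n -> simplex n -> simplex m;
  sact_id : forall n (x : simplex n), sact (did n) x = x;
  sact_comp : forall l m n (f : dmap m n) (g : dmap l m) (x : simplex n),
    sact (dcomp f g) x = sact g (sact f x) }.
Arguments sact X {m n} f x : rename.

Definition reduced0 (X : sset) := exists pt : X 0, forall y : X 0, y = pt.

(* Monotone maps are given by an untyped function [f : nat -> nat],
   to avoid casts between dimensions.  [vmap m n f] is the restriction of [f]
   to a map {0..m} -> {0..n}; it is meaningful only when [dvalid m n f]. *)
Definition dvalid m n (f : nat -> nat) :=
  (forall i j, i <= j <= m -> f i <= f j)%N /\ (forall i, i <= m -> f i <= n)%N.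

Lemma dconst0_subproof m n :
  [forall i : 'I_m.+1, forall j : 'I_m.+1,
    (i <= j) ==> ([ffun _ : 'I_m.+1 => ord0 : 'I_n.+1] i <= [ffun _ : 'I_m.+1 => ord0 : 'I_n.+1] j)]%N.
Proof. by apply/'forall_forallP => i j; rewrite !ffunE leqnn implybT. Qed.

Definition vmap m n (f : nat -> nat) : dmap m n :=
  insubd (DMap (dconst0_subproof m n)) [ffun i : 'I_m.+1 => inord (f i)].

Lemma vmapE m n f (i : 'I_m.+1) : dvalid m n f -> vmap m n f i = f i :> nat.
Proof.
move=> [fm fn]; rewrite /vmap /insubd insubT /= => [|_]; last first.
  by rewrite ffunE inordK // ltnS fn // -ltnS.
apply/'forall_forallP => j k; apply/implyP => jk; rewrite !ffunE.
have lem (l : 'I_m.+1) : (l <= m)%N by rewrite -ltnS.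
by rewrite !inordK ?ltnS ?fn ?fm ?jk ?lem.
Qed.

(* x_(f(0),...,f(m)) *)
Definition pull (X : sset) m n (f : nat -> nat) (x : X n) : X m :=
  sact X (vmap m n f) x.
Arguments pull {X} m {n} f x.

Lemma eq_pull (X : sset) m n f g (x : X n) :
  (forall i, i <= m -> f i = g i)%N -> pull m f x = pull m g x.
Proof.
move=> fg; rewrite /pull /vmap; congr (sact X (insubd _ _) x).
by apply/ffunP => i; rewrite !ffunE fg // -ltnS.
Qed.

Lemma pull_id (X : sset) n (x : X n) : pull n id x = x.
Proof.
rewrite /pull -[RHS]sact_id; congr sact; apply: dmap_eq => i.
rewrite vmapE ?ffunE //; split=> // j k; by case/andP.
Qed.

Lemma pull_comp (X : sset) l m n f g (x : X n) :
  dvalid m n f -> dvalid l m g -> pull l g (pull m f x) = pull l (f \o g) x.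
Proof.
move=> vf vg; rewrite /pull -sact_comp; congr sact; apply: dmap_eq => i.
rewrite [RHS]vmapE; last first.
  case: vf vg => [fm fn] [gm gn]; split=> [j k /andP[jk km]|j jm] /=.
    by apply: fm; rewrite gm ?jk //= gn.
  exact/fn/gn.
by rewrite /= ffunE vmapE // vmapE.
Qed.

Lemma sact_pull (X : sset) m n (f : dmap m n) (x : X n) :
  sact X f x = pull m (fun k => f (inord k)) x.
Proof.
congr sact; apply: dmap_eq => i; rewrite vmapE ?inord_val //; split.
  move=> j k /andP[jk km]; apply: dfun_le.
  by rewrite !inordK ?ltnS // (leq_trans jk).
by move=> j _; rewrite -ltnS.
Qed.

(* [bump i] is the coface map omitting [i], [unbump i] the codegeneracy
   hitting [i] twice. *)
Definition dface (X : sset) n (i : nat) (x : X n.+1) : X n := pull n (bump i) x.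
Definition sdeg (X : sset) n (i : nat) (x : X n) : X n.+1 := pull n.+1 (unbump i) x.

Definition degenerate (X : sset) (n : nat) : X n -> Prop :=
  match n return X n -> Prop with
  | 0 => fun _ => False
  | m.+1 => fun x => exists i (y : X m), (i <= m)%N /\ x = sdeg i y
  end.
Arguments degenerate {X n} x.

Lemma dvalid_id n : dvalid n n id.
Proof. by split=> // i j /andP[]. Qed.

Lemma dvalid_comp l m n f g : dvalid m n f -> dvalid l m g -> dvalid l n (f \o g).
Proof.
move=> [fm fn] [gm gn]; split=> [j k /andP[jk km]|j jm] /=; last exact/fn/gn.
by apply: fm; rewrite gm ?jk //= gn.
Qed.

Lemma dvalid_bump n i : dvalid n n.+1 (bump i).
Proof. by split=> [j k|j]; rewrite /bump; lia. Qed.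

Lemma dvalid_unbump n i : (i <= n)%N -> dvalid n.+1 n (unbump i).
Proof. by move=> ?; split=> [j k|j]; rewrite /unbump; lia. Qed.

Lemma dvalid_dmap m n (f : dmap m n) : dvalid m n (fun k => f (inord k)).
Proof.
split=> [j k /andP[jk km]|j _]; last by rewrite -ltnS.
by apply: dfun_le; rewrite !inordK ?ltnS // (leq_trans jk).
Qed.

Section PresentedGroup.
Variables (T : Type) (rel1 : T -> Prop).

(* The letter (b, t) stands for t if b is true and for its inverse otherwise. *)
Definition gword := seq (bool * T).
HB.instance Definition _ := gen_eqMixin gword.
HB.instance Definition _ := gen_choiceMixin gword.

Inductive gcong : gword -> gword -> Prop :=
| gcong_refl w : gcong w w
| gcong_sym w w' : gcong w w' -> gcong w' w
| gcong_trans w w' w'' : gcong w w' -> gcong w' w'' -> gcong w w''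
| gcong_cat u u' w w' : gcong u u' -> gcong w w' -> gcong (u ++ w) (u' ++ w')
| gcong_inv b t : gcong [:: (b, t); (~~ b, t)] [::]
| gcong_rel t : rel1 t -> gcong [:: (true, t)] [::].

Definition gcongb (w w' : gword) : bool := `[< gcong w w' >].
Lemma gcongb_equiv : equiv_class_of gcongb.
Proof.
split=> [w|w w'|w w' w'']; first exact/asboolP/gcong_refl.
  by apply/asboolP/asboolP; apply: gcong_sym.
by move=> /asboolP h /asboolP h'; apply/asboolP/(gcong_trans h).
Qed.
Canonical gcongb_equiv_rel := EquivRelPack gcongb_equiv.
Definition pgroup := {eq_quot gcongb}.
HB.instance Definition _ := Choice.on pgroup.
HB.instance Definition _ := Quotient.on pgroup.

Definition gclass (w : gword) : pgroup := \pi_pgroup w.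

Lemma gclassP w w' : gclass w = gclass w' <-> gcong w w'.
Proof.
rewrite /gclass; split=> [/eqmodP/asboolP //|h].
by apply/eqmodP/asboolP.
Qed.

Definition ginvw (w : gword) : gword := rev [seq (~~ a.1, a.2) | a <- w].

Lemma gcong_catV w : gcong (w ++ ginvw w) [::].
Proof.
elim: w => [|[b t] w IH]; first exact: gcong_refl.
rewrite /ginvw /= rev_cons -cats1 catA.
apply: gcong_trans (gcong_inv b t).
apply: (gcong_cat (u := [:: (b, t)]) (u' := [:: (b, t)])); first exact: gcong_refl.
by apply: (gcong_cat (w := [:: (~~ b, t)]) IH); apply: gcong_refl.
Qed.

Lemma ginvwK w : ginvw (ginvw w) = w.
Proof.
rewrite /ginvw map_rev revK -map_comp -[RHS]map_id.
by apply: eq_map => -[b t] /=; rewrite negbK.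
Qed.

Lemma gcong_ginv w w' : gcong w w' -> gcong (ginvw w) (ginvw w').
Proof.
move=> h.
apply: (@gcong_trans _ (ginvw w ++ (w' ++ ginvw w'))).
  rewrite -[X in gcong X]cats0; apply: gcong_cat; first exact: gcong_refl.
  exact/gcong_sym/gcong_catV.
rewrite catA -[X in gcong _ X]cat0s; apply: gcong_cat; last exact: gcong_refl.
apply: (@gcong_trans _ (ginvw w ++ w)).
  by apply: gcong_cat (gcong_refl _) (gcong_sym h).
by rewrite -[X in _ ++ X]ginvwK; apply: gcong_catV.
Qed.

Definition pg_one : pgroup := gclass [::].
Definition pg_mul (g h : pgroup) : pgroup := gclass (repr g ++ repr h).
Definition pg_inv (g : pgroup) : pgroup := gclass (ginvw (repr g)).

Lemma gclassK g : gclass (repr g) = g. Proof. exact: reprK. Qed.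
Lemma gcong_repr w : gcong (repr (gclass w)) w.
Proof. by apply/gclassP; rewrite gclassK. Qed.

Lemma pg_mulE w w' : pg_mul (gclass w) (gclass w') = gclass (w ++ w').
Proof. by apply/gclassP/gcong_cat; apply: gcong_repr. Qed.
Lemma pg_invE w : pg_inv (gclass w) = gclass (ginvw w).
Proof. by apply/gclassP/gcong_ginv/gcong_repr. Qed.

Lemma pg_mulA : associative pg_mul.
Proof.
move=> a b c; rewrite -[a]gclassK -[b]gclassK -[c]gclassK.
by rewrite !pg_mulE catA.
Qed.
Lemma pg_mul1g : left_id pg_one pg_mul.
Proof. by move=> a; rewrite -[a]gclassK pg_mulE. Qed.
Lemma pg_mulg1 : right_id pg_one pg_mul.
Proof. by move=> a; rewrite -[a]gclassK pg_mulE cats0. Qed.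
Lemma pg_mulV : left_inverse pg_one pg_inv pg_mul.
Proof.
move=> a; rewrite -[a]gclassK pg_invE pg_mulE; apply/gclassP.
by rewrite -[X in _ ++ X]ginvwK; apply: gcong_catV.
Qed.
Lemma pg_Vmul : right_inverse pg_one pg_inv pg_mul.
Proof.
by move=> a; rewrite -[a]gclassK pg_invE pg_mulE; apply/gclassP/gcong_catV.
Qed.
HB.instance Definition _ :=
  isGroup.Build pgroup pg_mulA pg_mul1g pg_mulg1 pg_mulV pg_Vmul.

Definition pgen (t : T) : pgroup := gclass [:: (true, t)].

Lemma pgen_rel t : rel1 t -> pgen t = 1%g.
Proof. by move=> h; apply/gclassP/gcong_rel. Qed.

Lemma pgenV t : (pgen t)^-1%g = gclass [:: (false, t)].
Proof. exact: pg_invE. Qed.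

Lemma pgroup_ind (P : pgroup -> Prop) :
  P 1%g -> (forall t g, P g -> P (pgen t * g)%g) ->
  (forall t g, P g -> P ((pgen t)^-1 * g)%g) -> forall g, P g.
Proof.
move=> P1 PM PV g; rewrite -[g]gclassK; elim: (repr g) => [//|[b t] w IH].
have -> : gclass ((b, t) :: w) = (gclass [:: (b, t)] * gclass w)%g.
  by rewrite [RHS]pg_mulE.
by case: b; [apply: PM | rewrite -pgenV; apply: PV].
Qed.

Section Lift.
Variables (H : groupType) (f : T -> H).
Hypothesis f1 : forall t, rel1 t -> f t = 1%g.

Definition gword_eval (w : gword) : H :=
  foldr (fun a h => (if a.1 then f a.2 else (f a.2)^-1) * h)%g 1%g w.

Lemma gword_eval_cat u w : gword_eval (u ++ w) = (gword_eval u * gword_eval w)%g.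
Proof. by elim: u => [|a u IH] /=; rewrite ?mul1g // IH mulgA. Qed.

Lemma gword_eval_cong w w' : gcong w w' -> gword_eval w = gword_eval w'.
Proof.
elim=> //= {w w'} [w w' w'' _ -> _ ->//|u u' w w' _ hu _ hw|[] t|t ht] /=.
- by rewrite !gword_eval_cat hu hw.
- by rewrite mulg1 mulgV.
- by rewrite mulg1 mulVg.
- by rewrite f1 // mulg1.
Qed.

Definition pg_lift (g : pgroup) : H := gword_eval (repr g).

Lemma pg_lift_class w : pg_lift (gclass w) = gword_eval w.
Proof. exact/gword_eval_cong/gcong_repr. Qed.
Lemma pg_lift_gen t : pg_lift (pgen t) = f t.
Proof. by rewrite pg_lift_class /= mulg1. Qed.
Lemma pg_lift1 : pg_lift 1%g = 1%g.
Proof. exact: pg_lift_class. Qed.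
Lemma pg_liftM g h : pg_lift (g * h)%g = (pg_lift g * pg_lift h)%g.
Proof.
rewrite -[g]gclassK -[h]gclassK [X in pg_lift X]pg_mulE !pg_lift_class.
exact: gword_eval_cat.
Qed.
Lemma pg_liftV g : pg_lift (g^-1)%g = ((pg_lift g)^-1)%g.
Proof. by apply/esym/mulg1_eq; rewrite -pg_liftM mulgV pg_lift1. Qed.
End Lift.

End PresentedGroup.

Section LoopGroup.
Variable X : sset.

(* F(X_{n+1}) / F(s_0 X_n) *)
Definition loop_rel n (x : X n.+1) : Prop := exists y : X n, x = sdeg 0 y.
Definition loop n := pgroup (@loop_rel n).
HB.instance Definition _ n := Group.on (loop n).
Definition tau n (x : X n.+1) : loop n := pgen (@loop_rel n) x.

Lemma tau_s0 n (y : X n) : tau (sdeg 0 y) = 1%g.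
Proof. by apply: pgen_rel; exists y. Qed.

(* A map f : {0..m} -> {0..n} sends tau x to
     (tau x_(1,f(0)+1,...,f(m)+1))^-1 * tau x_(0,f(0)+1,...,f(m)+1).
   If f(0) = 0, then the first factor is trivial.  [kan_sdeg], [kan_face0]
   and [kan_faceS] below are the usual formulas for this structure on the
   generators. *)
Definition dshift m n c (f : dmap m n) (k : nat) : nat :=
  if k is l.+1 then (f (inord l)).+1 else c.

Definition loop_act_gen m n (f : dmap m n) (x : X n.+1) : loop m :=
  ((tau (pull m.+1 (dshift 1 f) x))^-1 * tau (pull m.+1 (dshift 0 f) x))%g.

Lemma dvalid_dshift m n c (f : dmap m n) : (c <= 1)%N -> dvalid m.+1 n.+1 (dshift c f).
Proof.
move=> c1; have [vm vn] := dvalid_dmap f; split=> [[|j] [|k] jk|[|j] jm] //=.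
- exact: leq_trans c1 _.
- by rewrite ltnS; apply: vm.
- exact: leq_trans c1 _.
Qed.

#[local] Hint Extern 0 (dvalid _ _ _) => (by [exact: dvalid_bump
  | exact: dvalid_unbump | exact: dvalid_dshift]) : core.

Lemma loop_act_gen1 m n (f : dmap m n) x : loop_rel x -> loop_act_gen f x = 1%g.
Proof.
move=> [y ->]; rewrite /loop_act_gen /sdeg !pull_comp //.
have -> : pull m.+1 (unbump 0 \o dshift 1 f) y = pull m.+1 (unbump 0 \o dshift 0 f) y.
  by apply: eq_pull => -[].
exact: mulVg.
Qed.

Definition loop_act m n (f : dmap m n) : loop n -> loop m :=
  pg_lift (@loop_act_gen m n f).

Lemma loop_actM m n (f : dmap m n) g h :
  loop_act f (g * h)%g = (loop_act f g * loop_act f h)%g.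
Proof. exact/pg_liftM/loop_act_gen1. Qed.
Lemma loop_actV m n (f : dmap m n) g : loop_act f (g^-1)%g = ((loop_act f g)^-1)%g.
Proof. exact/pg_liftV/loop_act_gen1. Qed.
Lemma loop_act1 m n (f : dmap m n) : loop_act f 1%g = 1%g.
Proof. exact/pg_lift1/loop_act_gen1. Qed.
Lemma loop_act_tau m n (f : dmap m n) x : loop_act f (tau x) = loop_act_gen f x.
Proof. exact/pg_lift_gen/loop_act_gen1. Qed.

Lemma tau_eq1 n f (x : X n) m : dvalid m.+1 n f -> f 0 = f 1 ->
  tau (pull m.+1 f x) = 1%g.
Proof.
move=> vf f01; rewrite -[RHS](tau_s0 (pull m (f \o bump 0) x)) /sdeg.
rewrite pull_comp //; last exact: dvalid_comp (dvalid_bump _ _).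
by congr tau; apply: eq_pull => -[|i] //= _; rewrite /bump /unbump /= ?add1n ?subn1.
Qed.

Lemma loop_act_id n (g : loop n) : loop_act (did n) g = g.
Proof.
elim/pgroup_ind: g => [|x g IH|x g IH]; first exact: loop_act1.
all: rewrite loop_actM ?loop_actV IH -/(tau x) loop_act_tau; congr (_ * _)%g.
  rewrite /loop_act_gen tau_eq1 ?invg1 ?mul1g; last 2 first.
  - exact: dvalid_dshift.
  - by rewrite /= ffunE inordK.
  rewrite -[in RHS](pull_id x); congr tau; apply: eq_pull => -[|i] //= ni.
  by rewrite ffunE inordK.
congr (_^-1)%g.
rewrite /loop_act_gen tau_eq1 ?invg1 ?mul1g; last 2 first.
- exact: dvalid_dshift.
- by rewrite /= ffunE inordK.
rewrite -[in RHS](pull_id x); congr tau; apply: eq_pull => -[|i] //= ni.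
by rewrite ffunE inordK.
Qed.

Lemma loop_act_comp l m n (f : dmap m n) (k : dmap l m) (g : loop n) :
  loop_act (dcomp f k) g = loop_act k (loop_act f g).
Proof.
have gen x : loop_act (dcomp f k) (tau x) = loop_act k (loop_act f (tau x)).
  rewrite !loop_act_tau loop_actM loop_actV !loop_act_tau /loop_act_gen.
  rewrite !pull_comp // invgM invgK mulgA.
  have e c d : pull l.+1 (dshift d f \o dshift c.+1 k) x =
               pull l.+1 (dshift 0 f \o dshift c.+1 k) x.
    by apply: eq_pull => -[].
  rewrite (e 0%N 1%N) mulgK.
  congr ((tau _)^-1 * tau _)%g; apply: eq_pull => -[|i] //= il.
    by rewrite ffunE inord_val.
  by rewrite ffunE inord_val.
elim/pgroup_ind: g => [|x g IH|x g IH]; first by rewrite !loop_act1.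
  by rewrite !loop_actM IH -/(tau x) gen.
by rewrite !loop_actM !loop_actV IH -/(tau x) gen.
Qed.

Definition kan : sset := SSet loop_act_id loop_act_comp.

Lemma kan_pullM m n f (g h : loop n) :
  pull (X := kan) m f (g * h : loop n)%g = (pull (X := kan) m f g * pull (X := kan) m f h : loop m)%g.
Proof. exact: loop_actM. Qed.

Lemma kan_pull_tau m n f (x : X n.+1) : dvalid m n f ->
  pull (X := kan) m f (tau x) =
  ((tau (pull m.+1 (fun k => if k is l.+1 then (f l).+1 else 1%N) x))^-1 *
    tau (pull m.+1 (fun k => if k is l.+1 then (f l).+1 else 0%N) x))%g :> loop m.
Proof.
move=> vf; rewrite /pull /= loop_act_tau /loop_act_gen.
by congr ((tau _)^-1 * tau _)%g; apply: eq_pull => -[|i] //= im;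
  rewrite vmapE ?inordK.
Qed.

Lemma kan_sdeg n i (x : X n.+1) : (i <= n)%N ->
  sdeg (X := kan) i (tau x) = tau (sdeg i.+1 x).
Proof.
move=> le_in; rewrite /sdeg kan_pull_tau //.
have vs c : (c <= 1)%N -> dvalid n.+2 n.+1 (fun k => if k is l.+1 then (unbump i l).+1 else c).
  move=> c1; have [vm vn] := dvalid_unbump le_in; split=> [[|j] [|k] jk|[|j] jm] //=.
  - exact: leq_trans c1 _.
  - by rewrite ltnS; apply: vm.
  - exact: leq_trans c1 _.
  - by rewrite ltnS; apply: vn.
rewrite tau_eq1 ?invg1 ?mul1g; last 2 first.
- exact: vs.
- by [].
by congr tau; apply: eq_pull => -[|k] //= _; rewrite /unbump; lia.
Qed.

Lemma kan_face0 n (x : X n.+2) :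
  dface (X := kan) 0 (tau x) = ((tau (dface 0 x))^-1 * tau (dface 1 x))%g :> loop n.
Proof.
rewrite /dface kan_pull_tau //.
by congr ((tau _)^-1 * tau _)%g; apply: eq_pull => -[|k].
Qed.

Lemma kan_faceS n i (x : X n.+2) :
  dface (X := kan) i.+1 (tau x) = tau (dface i.+2 x) :> loop n.
Proof.
rewrite /dface kan_pull_tau // tau_eq1 ?invg1 ?mul1g; last 2 first.
- have [vm vn] := dvalid_bump n i.+1; split=> [[|j] [|k] jk|[|j] jm] //=.
  by rewrite ltnS; apply: vm.
  by rewrite ltnS; apply: vn.
- by [].
by congr tau; apply: eq_pull => -[|k] _ /=; rewrite ?bumpS.
Qed.

End LoopGroup.

Section Chains.
Variable X : sset.

Definition ndloop :=
  {s : {n : nat & loop X n} | `[< ~ degenerate (X := kan X) (tagged s) >]}.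
Definition CG := {freeg ndloop / int}.

(* The class of a simplex in CG; degenerate simplices become 0. *)
Definition chain n (g : loop X n) : CG :=
  if insub (Tagged (loop X) g) is Some s then << (s : ndloop) >> else 0.

Definition homogCG n (c : CG) : Prop :=
  forall s : ndloop, s \in dom c -> tag (val s) = n.

Definition bd_simplex n : loop X n -> CG :=
  match n return loop X n -> CG with
  | 0 => fun _ => 0
  | m.+1 => fun g =>
      \sum_(i < m.+2) (-1 : int) ^+ i *: chain (dface (X := kan X) i g)
  end.

Definition bd (c : CG) : CG :=
  fglift (fun s : ndloop => bd_simplex (tagged (val s))) c.

(* A (p,q)-shuffle, as the permutation (nu(1),...,nu(p),mu(1),...,mu(q)) *)
Definition shuffle p q (w : 'S_(p + q)) : bool :=
  [forall i : 'I_(p + q), forall j : 'I_(p + q),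
    (i < j) && ((j < p) || (p <= i)) ==> (w i < w j)]%N.
Definition shuffle_nu p q (w : 'S_(p + q)) : seq nat :=
  [seq val (w (lshift q i)) | i <- enum 'I_p].
Definition shuffle_mu p q (w : 'S_(p + q)) : seq nat :=
  [seq val (w (rshift p i)) | i <- enum 'I_q].

(* The map underlying s_{i_k} ... s_{i_1} for the sequence i_1, ..., i_k *)
Definition iter_unbump (s : seq nat) (k : nat) : nat := foldr unbump k s.

Definition shuffle_mul p q (g : loop X p) (h : loop X q) : CG :=
  \sum_(w : 'S_(p + q) | shuffle w) (-1 : int) ^+ w *:
    chain ((pull (X := kan X) (p + q) (iter_unbump (shuffle_mu w)) g : loop X (p + q)) *
           (pull (X := kan X) (p + q) (iter_unbump (shuffle_nu w)) h : loop X (p + q)))%g.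

Definition mulCG (c c' : CG) : CG :=
  fglift (fun s : ndloop =>
    fglift (fun t : ndloop => shuffle_mul (tagged (val s)) (tagged (val t))) c') c.

End Chains.

Section Cobar.
Variable X : sset.

(* [CoS x] stands for s^{-1}x, which has degree n for x in X_{n+1}, and
   [CoXi x] for xi_x.  Degenerate simplices are allowed here; the relations
   [cc_s_deg] and [cc_xi_deg] remove them again. *)
Inductive coterm : Type :=
| CoS n (x : X n.+1)
| CoXi (x : X 1)
| CoZero | CoOne
| CoOpp (a : coterm)
| CoAdd (a b : coterm)
| CoMul (a b : coterm).

HB.instance Definition _ := gen_eqMixin coterm.
HB.instance Definition _ := gen_choiceMixin coterm.

Inductive cocong : coterm -> coterm -> Prop :=
| cc_refl a : cocong a a
| cc_sym a b : cocong a b -> cocong b a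
| cc_trans a b c : cocong a b -> cocong b c -> cocong a c
| cc_opp a a' : cocong a a' -> cocong (CoOpp a) (CoOpp a')
| cc_add a a' b b' : cocong a a' -> cocong b b' -> cocong (CoAdd a b) (CoAdd a' b')
| cc_mul a a' b b' : cocong a a' -> cocong b b' -> cocong (CoMul a b) (CoMul a' b')
| cc_addA a b c : cocong (CoAdd a (CoAdd b c)) (CoAdd (CoAdd a b) c)
| cc_addC a b : cocong (CoAdd a b) (CoAdd b a)
| cc_add0 a : cocong (CoAdd CoZero a) a
| cc_addN a : cocong (CoAdd (CoOpp a) a) CoZero
| cc_mulA a b c : cocong (CoMul a (CoMul b c)) (CoMul (CoMul a b) c)
| cc_mul1 a : cocong (CoMul CoOne a) a
| cc_1mul a : cocong (CoMul a CoOne) a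
| cc_mulDl a b c : cocong (CoMul (CoAdd a b) c) (CoAdd (CoMul a c) (CoMul b c))
| cc_mulDr a b c : cocong (CoMul a (CoAdd b c)) (CoAdd (CoMul a b) (CoMul a c))
| cc_s_deg n (x : X n.+1) : degenerate x -> cocong (CoS x) CoZero
| cc_xi_deg (x : X 1) : degenerate x -> cocong (CoXi x) CoOne
| cc_xiV (x : X 1) : ~ degenerate x -> cocong (CoMul (CoXi x) (CoAdd CoOne (CoS x))) CoOne
| cc_Vxi (x : X 1) : ~ degenerate x -> cocong (CoMul (CoAdd CoOne (CoS x)) (CoXi x)) CoOne.

Definition cocongb (a b : coterm) : bool := `[< cocong a b >].
Lemma cocongb_equiv : equiv_class_of cocongb.
Proof.
split=> [w|w w'|w w' w'']; first exact/asboolP/cc_refl.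
  by apply/asboolP/asboolP; apply: cc_sym.
by move=> /asboolP h /asboolP h'; apply/asboolP/(cc_trans h).
Qed.
Canonical cocongb_equiv_rel := EquivRelPack cocongb_equiv.
Definition cobar := {eq_quot cocongb}.
HB.instance Definition _ := Choice.on cobar.
HB.instance Definition _ := Quotient.on cobar.

Definition coclass (a : coterm) : cobar := \pi_cobar a.

Lemma coclassP a b : coclass a = coclass b <-> cocong a b.
Proof.
rewrite /coclass; split=> [/eqmodP/asboolP //|h].
by apply/eqmodP/asboolP.
Qed.
Lemma coclassK g : coclass (repr g) = g. Proof. exact: reprK. Qed.
Lemma cocong_repr w : cocong (repr (coclass w)) w.
Proof. by apply/coclassP; rewrite coclassK. Qed.

Definition co_opp (a : cobar) := coclass (CoOpp (repr a)).
Definition co_add (a b : cobar) := coclass (CoAdd (repr a) (repr b)).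
Definition co_mul (a b : cobar) := coclass (CoMul (repr a) (repr b)).

Lemma co_oppE a : co_opp (coclass a) = coclass (CoOpp a).
Proof. exact/coclassP/cc_opp/cocong_repr. Qed.
Lemma co_addE a b : co_add (coclass a) (coclass b) = coclass (CoAdd a b).
Proof. by apply/coclassP/cc_add; apply: cocong_repr. Qed.
Lemma co_mulE a b : co_mul (coclass a) (coclass b) = coclass (CoMul a b).
Proof. by apply/coclassP/cc_mul; apply: cocong_repr. Qed.

Let coE := (co_oppE, co_addE, co_mulE).

Lemma co_addA : associative co_add.
Proof.
move=> a b c; rewrite -[a]coclassK -[b]coclassK -[c]coclassK !coE.
exact/coclassP/cc_addA.
Qed.
Lemma co_addC : commutative co_add.
Proof.
move=> a b; rewrite -[a]coclassK -[b]coclassK !coE; exact/coclassP/cc_addC.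
Qed.
Lemma co_add0 : left_id (coclass CoZero) co_add.
Proof. by move=> a; rewrite -[a]coclassK !coE; apply/coclassP/cc_add0. Qed.
Lemma co_addN : left_inverse (coclass CoZero) co_opp co_add.
Proof. by move=> a; rewrite -[a]coclassK !coE; apply/coclassP/cc_addN. Qed.
Lemma co_mulA : associative co_mul.
Proof.
move=> a b c; rewrite -[a]coclassK -[b]coclassK -[c]coclassK !coE.
exact/coclassP/cc_mulA.
Qed.
Lemma co_mul1 : left_id (coclass CoOne) co_mul.
Proof. by move=> a; rewrite -[a]coclassK !coE; apply/coclassP/cc_mul1. Qed.
Lemma co_1mul : right_id (coclass CoOne) co_mul.
Proof. by move=> a; rewrite -[a]coclassK !coE; apply/coclassP/cc_1mul. Qed.
Lemma co_mulDl : left_distributive co_mul co_add.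
Proof.
move=> a b c; rewrite -[a]coclassK -[b]coclassK -[c]coclassK !coE.
exact/coclassP/cc_mulDl.
Qed.
Lemma co_mulDr : right_distributive co_mul co_add.
Proof.
move=> a b c; rewrite -[a]coclassK -[b]coclassK -[c]coclassK !coE.
exact/coclassP/cc_mulDr.
Qed.

HB.instance Definition _ := GRing.isPzRing.Build cobar
  co_addA co_addC co_add0 co_addN co_mulA co_mul1 co_1mul co_mulDl co_mulDr.

Definition cos n (x : X n.+1) : cobar := coclass (CoS x).
Definition coxi (x : X 1) : cobar := coclass (CoXi x).

Lemma cos_deg n (x : X n.+1) : degenerate x -> cos x = 0.
Proof. by move=> dx; apply/coclassP/cc_s_deg. Qed.
Lemma coxi_deg (x : X 1) : degenerate x -> coxi x = 1.
Proof. by move=> dx; apply/coclassP/cc_xi_deg. Qed.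

Lemma coxi_mul (x : X 1) : coxi x * (1 + cos x) = 1.
Proof.
have [dx|ndx] := pselect (degenerate x).
  by rewrite coxi_deg // cos_deg // mul1r addr0.
by rewrite [_ + _]co_addE [LHS]co_mulE; apply/coclassP/cc_xiV.
Qed.
Lemma mul_coxi (x : X 1) : (1 + cos x) * coxi x = 1.
Proof.
have [dx|ndx] := pselect (degenerate x).
  by rewrite coxi_deg // cos_deg // mulr1 addr0.
by rewrite [_ + _]co_addE [LHS]co_mulE; apply/coclassP/cc_Vxi.
Qed.

Lemma cobar_ind (P : cobar -> Prop) :
  P 1 -> (forall n (x : X n.+1), ~ degenerate x -> P (cos x)) ->
  (forall x : X 1, ~ degenerate x -> P (coxi x)) ->
  (forall a b, P a -> P b -> P (a - b)) ->
  (forall a b, P a -> P b -> P (a * b)) -> forall a, P a.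
Proof.
move=> P1 Ps Pxi PB PM a; rewrite -[a]coclassK.
have P0 : P 0 by rewrite -(subrr 1); apply: PB.
elim: (repr a) => {a} [n x|x|||a IHa|a IHa b IHb|a IHa b IHb] //.
- have [dx|] := pselect (degenerate x); last exact: Ps.
  by rewrite -/(cos x) cos_deg.
- have [dx|] := pselect (degenerate x); last exact: Pxi.
  by rewrite -/(coxi x) coxi_deg.
- by have := PB _ _ P0 IHa; rewrite sub0r [- _]co_oppE.
- by have := PB _ _ IHa (PB _ _ P0 IHb); rewrite sub0r opprK [_ + _]co_addE.
- by rewrite -co_mulE; apply: PM.
Qed.

Inductive homogCo : nat -> cobar -> Prop :=
| homogCo0 n : homogCo n 0
| homogCoB n a b : homogCo n a -> homogCo n b -> homogCo n (a - b)
| homogCo1 : homogCo 0 1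
| homogCoM p q a b : homogCo p a -> homogCo q b -> homogCo (p + q) (a * b)
| homogCo_s n (x : X n.+1) : homogCo n (cos x)
| homogCo_xi (x : X 1) : homogCo 0 (coxi x).

(* The degree involution, a |-> (-1)^n a for a of degree n *)
Fixpoint coterm_sgn (a : coterm) : cobar :=
  match a with
  | CoS n x => (-1) ^+ n * cos x
  | CoXi x => coxi x
  | CoZero => 0
  | CoOne => 1
  | CoOpp a => - coterm_sgn a
  | CoAdd a b => coterm_sgn a + coterm_sgn b
  | CoMul a b => coterm_sgn a * coterm_sgn b
  end.

Definition cosgn (a : cobar) : cobar := coterm_sgn (repr a).

(* The differential on s^{-1}x for x in X_{n+1}; the r-th product of the sum
   is s^{-1}x_(0,...,r+1) * s^{-1}x_(r+1,...,n+1). *)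
Definition codiff_gen n : X n.+1 -> cobar :=
  match n return X n.+1 -> cobar with
  | 0 => fun _ => 0
  | m.+1 => fun x =>
      if `[< degenerate x >] then 0 else
      \sum_(r < m.+3) (-1) ^+ r.+1 * cos (dface r x) +
      \sum_(r < m.+1) (-1) ^+ r.+1 *
        (cos (pull r.+1 id x) * cos (pull (m - r).+1 (addn r.+1) x))
  end.

Fixpoint coterm_diff (a : coterm) : cobar :=
  match a with
  | CoS n x => codiff_gen x
  | CoXi x => 0
  | CoZero => 0
  | CoOne => 0
  | CoOpp a => - coterm_diff a
  | CoAdd a b => coterm_diff a + coterm_diff b
  | CoMul a b => coterm_diff a * coclass b + coterm_sgn a * coterm_diff b
  end.

Definition codiff (a : cobar) : cobar := coterm_diff (repr a).

Lemma coterm_sgn_cong a b : cocong a b -> coterm_sgn a = coterm_sgn b.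
Proof.
elim=> {a b} //=.
- by move=> a b c _ -> _ ->.
- by move=> a a' _ ->.
- by move=> a a' b b' _ -> _ ->.
- by move=> a a' b b' _ -> _ ->.
- by move=> a b c; rewrite addrA.
- by move=> a b; rewrite addrC.
- by move=> a; rewrite add0r.
- by move=> a; rewrite addNr.
- by move=> a b c; rewrite mulrA.
- by move=> a; rewrite mul1r.
- by move=> a; rewrite mulr1.
- by move=> a b c; rewrite mulrDl.
- by move=> a b c; rewrite mulrDr.
- by move=> n x dx; rewrite cos_deg // mulr0.
- by move=> x dx; rewrite coxi_deg.
- by move=> x _; rewrite expr0 mul1r coxi_mul.
- by move=> x _; rewrite expr0 mul1r mul_coxi.
Qed.

Lemma coterm_diff_cong a b : cocong a b -> coterm_diff a = coterm_diff b.
Proof.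
elim=> {a b} //=.
- by move=> a b c _ -> _ ->.
- by move=> a a' _ ->.
- by move=> a a' b b' _ -> _ ->.
- move=> a a' b b' /coterm_sgn_cong -> -> /coclassP -> ->; done.
- by move=> a b c; rewrite addrA.
- by move=> a b; rewrite addrC.
- by move=> a; rewrite add0r.
- by move=> a; rewrite addNr.
- move=> a b c; rewrite -co_mulE mulrDl mulrDr -!mulrA -addrA; congr (_ + _).
- by move=> a; rewrite mul0r add0r mul1r.
- by move=> a; rewrite mulr0 addr0 -[RHS]mulr1.
- by move=> a b c; rewrite !mulrDl addrACA.
- by move=> a b c; rewrite -co_addE !mulrDr addrACA.
- by move=> [|n] x dx //=; case: asboolP.
- by move=> x _; rewrite mul0r addr0 mulr0 add0r.
- by move=> x _; rewrite addr0 mul0r mulr0 addr0.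
Qed.

Lemma codiff_class a : codiff (coclass a) = coterm_diff a.
Proof. exact/coterm_diff_cong/cocong_repr. Qed.
Lemma cosgn_class a : cosgn (coclass a) = coterm_sgn a.
Proof. exact/coterm_sgn_cong/cocong_repr. Qed.

Lemma cosgn_homog n a : homogCo n a -> cosgn a = (-1) ^+ n * a.
Proof.
have sB b c : cosgn (b - c) = cosgn b - cosgn c.
  rewrite -[b]coclassK -[c]coclassK [- coclass _]co_oppE [_ + _]co_addE.
  by rewrite !cosgn_class.
elim=> {n a} [n|n a b _ IHa _ IHb||p q a b _ IHa _ IHb|n x|x].
- by rewrite cosgn_class mulr0.
- by rewrite sB IHa IHb mulrBr.
- by rewrite cosgn_class mulr1.
- have -> : cosgn (a * b) = cosgn a * cosgn b.
    rewrite -[a]coclassK -[b]coclassK [X in cosgn X]co_mulE !cosgn_class //.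
  rewrite IHa IHb exprD -!mulrA; congr (_ * _); rewrite !mulrA; congr (_ * b).
  exact/commrX/commrN1.
- exact: cosgn_class.
- by rewrite cosgn_class expr0 mul1r.
Qed.

Lemma codiffB a b : codiff (a - b) = codiff a - codiff b.
Proof.
rewrite -[a]coclassK -[b]coclassK [- coclass _]co_oppE [_ + _]co_addE.
by rewrite !codiff_class.
Qed.

Lemma codiffM n a b : homogCo n a ->
  codiff (a * b) = codiff a * b + (-1) ^+ n * (a * codiff b).
Proof.
move=> ha; rewrite mulrA -cosgn_homog //.
rewrite -[a]coclassK -[b]coclassK [X in codiff X]co_mulE !codiff_class.
by rewrite cosgn_class.
Qed.

Lemma codiff_xi x : codiff (coxi x) = 0.
Proof. exact: codiff_class. Qed.
Lemma codiff_s n (x : X n.+1) : codiff (cos x) = codiff_gen x.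
Proof. exact: codiff_class. Qed.

End Cobar.

(* A simplicial operator is represented by its underlying monotone map, so
   that the map of a composite operator  theta eta  is the map of eta after
   that of theta.  [nf_map] is the map of s_{i_1}...s_{i_q} d_{j_1}...d_{j_r}. *)
Definition nf_map (i j : seq nat) (k : nat) : nat :=
  foldl (fun l a => bump a l) (foldl (fun l a => unbump a l) k i) j.

Definition derived (f : nat -> nat) (k : nat) : nat :=
  if k is l.+1 then (f l).+1 else 0.

Lemma derived_comp f g : derived (f \o g) =1 derived f \o derived g.
Proof. by case. Qed.
Lemma derived_bump a : derived (bump a) =1 bump a.+1.
Proof. by case=> // k /=; rewrite bumpS. Qed.
Lemma derived_unbump a : derived (unbump a) =1 unbump a.+1.
Proof. by case=> // k /=; rewrite /unbump; lia. Qed.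

Lemma derived_nf i j :
  derived (nf_map i j) =1 nf_map [seq a.+1 | a <- i] [seq a.+1 | a <- j].
Proof.
move=> k; rewrite /nf_map.
case: k => [|k] /=.
  have -> : foldl (fun l a => unbump a l) 0%N [seq a.+1 | a <- i] = 0%N by elim: i.
  by elim: j.
rewrite [in RHS](_ : foldl _ k.+1 _ = (foldl (fun l a => unbump a l) k i).+1).
  move: (foldl _ k i) => {i}k; elim: j k => //= a j IH k.
  by rewrite bumpS IH.
elim: i k => //= a i IH k; rewrite -IH; congr foldl.
by rewrite -/(derived (unbump a) k.+1) derived_unbump.
Qed.

(* On an operator in normal form, [derived] is the derived operator by
   [derived_nf].  [Dmap s j] is the map {0..n} -> {0..n-j} of D^{n+1}_{j;s}, n = size s. *)
Fixpoint Dmap (s : seq nat) (j : nat) : nat -> nat :=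
  if s is i1 :: s' then
    if (j < i1)%N then bump (i1 - j) \o unbump 0 \o derived (Dmap s' j)
    else if j == i1 then derived (Dmap s' j)
    else unbump 0 \o derived (Dmap s' j.-1)
  else id.

(* [mem_Sseq] and [uniq_Sseq] below: this lists S_n without repetition. *)
Fixpoint Sseq (n : nat) : seq (seq nat) :=
  if n is m.+1 then [seq a :: s | a <- iota 0 m.+1, s <- Sseq m] else [:: [::]].

Lemma mem_Sseq n s :
  (s \in Sseq n) <-> size s = n /\ forall k, (k < n)%N -> (nth 0 s k <= n - k.+1)%N.
Proof.
elim: n s => [|n IH] s; first by case: s => [|a s]; split=> // -[].
split=> [/allpairsP[[a t] [+ /IH[st ht] ->]]|].
  rewrite mem_iota add0n /= => la; split=> [|[|k] kn] /=; first by rewrite st.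
    by rewrite subn1.
  by rewrite subSS ht.
case: s => [|a s] [] // [ss] hs; apply/allpairsP; exists (a, s); split=> //.
  by rewrite mem_iota; have := hs 0%N isT; rewrite /=; lia.
by apply/IH; split=> // k kn; have := hs k.+1 kn; rewrite subSS.
Qed.

Lemma uniq_Sseq n : uniq (Sseq n).
Proof.
elim: n => [//|n IH]; rewrite [Sseq _]/(Sseq n.+1).
apply: (@allpairs_uniq _ _ _ cons) => //; first exact: iota_uniq.
by move=> [a s] [b t] _ _ /= [-> ->].
Qed.

Section Maps.
Variable X : sset.

Definition Sz n (i : seq nat) (x : X n.+1) : loop X n :=
  (\prod_(j < n.+1)
    (pull (X := kan X) n (Dmap i j)
       (tau (pull (n - j).+1 (iter j (bump 0)) x)) : loop X n)^-1)%g.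

(* A homomorphism of differential graded algebras is an additive map that
   respects degrees, 1, products and differentials. *)
Record szczarba_map (phi : {additive cobar X -> CG X}) : Prop := SzczarbaMap {
  szczarba_homog : forall n a, homogCo n a -> homogCG n (phi a);
  szczarba_one : phi 1 = chain (1%g : loop X 0);
  szczarba_mul : forall a b, phi (a * b) = mulCG (phi a) (phi b);
  szczarba_diff : forall a, phi (codiff a) = bd (phi a);
  szczarba_xi : forall x : X 1, ~ degenerate x -> phi (coxi x) = chain (tau x);
  szczarba_s1 : forall x : X 1, ~ degenerate x ->
    phi (cos x) = chain ((tau x)^-1)%g - chain (1%g : loop X 0);
  szczarba_s : forall n (x : X n.+2), ~ degenerate x ->
    phi (cos x) = \sum_(i <- Sseq n.+1) (-1 : int) ^+ sumn i *: chain (Sz i x) }.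

(* [iter i (bump 1)] and [iter i (bump 0)] are the maps of d_1^i and d_0^i;
   the components psi_n are the restrictions of psi to chains of degree n. *)
Record retraction_map (psi : {additive CG X -> cobar X}) : Prop := RetractionMap {
  retraction_homog : forall n c, homogCG n c -> homogCo n (psi c);
  retraction_one : psi (chain (1%g : loop X 0)) = 1;
  retraction_rec : forall n (x : X n.+1) (g : loop X n),
    psi (chain (tau x * g)%g) =
    psi (chain g) -
    \sum_(i < n.+1) cos (pull i.+1 id x) *
      psi (chain ((tau (pull (n - i).+1 (iter i (bump 1)) x) *
                   (pull (X := kan X) (n - i) (iter i (bump 0)) g : loop X (n - i)))%g)) }.

End Maps.

(* Main.v *)
(* The identity follows from the stronger one
   psi (phi (a b)) = a psi (phi b), which passes to products, and to xi_x
   because xi_x inverts 1 + s^{-1}x.  What remains is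
   psi (phi (s^{-1}x) c) = s^{-1}x psi c for a simplex c = h.

   Write Sz_i x = (tau y)^{-1} s_p u with u a Szczarba simplex of d_0 x.  In the
   inverted recursion
     psi ((tau y)^{-1} g) = psi g
       + sum_k s^{-1}y_(0,...,k+1) psi (tau y_(1,k+1,k+2,...) d_0^k g)
   applied to one shuffle of Sz_i x and h, the k-th simplex y_(0,...,k+1) is
   degenerate unless the first k entries of i vanish and the shuffle starts with
   k steps in the direction of Sz_i x.  In that case tau y_(1,k+1,k+2,...)
   cancels the leading factors of d_0^k g, and what is left is a shuffle of a
   degenerate simplex with h, unless k = n.  So only i = (0,...,0) with the
   trivial shuffle contributes, and it contributes s^{-1}x psi h. *)
From HB Require Import structures.
Require Import Defs.
From mathcomp Require Import all_boot all_order perm all_algebra boolp freeg zify.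

Set Implicit Arguments.
Unset Strict Implicit.
Unset Printing Implicit Defensive.

Import GRing.Theory.
Local Open Scope ring_scope.

(** * Index sequences and the Szczarba operators *)

(** The bound on each entry is the number of entries after it, so [n] disappears from the condition
    and it passes to tails. *)
Fixpoint Sseqb (s : seq nat) : bool :=
  if s is a :: t then (a <= size t)%N && Sseqb t else true.

Lemma mem_SseqE n s : (s \in Sseq n) = (size s == n) && Sseqb s.
Proof.
elim: n s => [|n IH] [|a s] //; first by apply/negP => /allpairsP[[b t] []].
apply/idP/idP => [/allpairsP[[b t] []]|].
  rewrite mem_iota IH /= => lb /andP[/eqP st ht] [-> ->].
  by rewrite eqSS st eqxx ht andbT; lia.
case/andP=> /eqP[st] /andP[la ht]; apply/allpairsP; exists (a, s).
by split; rewrite // ?IH ?mem_iota /= ?st ?eqxx ?ht //; lia.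
Qed.

(** Because vertex 0 is fixed, such an operator sends [tau y] to a single generator. *)
Lemma Dmap0 s j : Dmap s j 0 = 0%N.
Proof.
case: s => [|a s] //=; case: ltnP => [lj|_]; last by case: eqP.
by rewrite /= (_ : unbump 0 0 = 0%N) // /bump leqn0 subn_eq0 leqNgt lj.
Qed.

Lemma dvalid_derived m n f : dvalid m n f -> dvalid m.+1 n.+1 (derived f).
Proof.
move=> [fm fn]; split=> [[|i] [|j] //|[|i] //]; last exact: fn.
by rewrite !ltnS => /fm.
Qed.

Lemma dvalid_Dmap s j : Sseqb s -> (j <= size s)%N ->
  dvalid (size s) (size s - j) (Dmap s j).
Proof.
elim: s j => [|a s IH] j /=; first by case: j => // _ _; apply: dvalid_id.
move=> /andP[la hs] lj; case: ltngtP => [lja|laj|eja].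
- have lj' : (j <= size s)%N by lia.
  have e : ((size s).+1 - j = (size s - j).+1)%N by lia.
  rewrite e; apply: dvalid_comp (dvalid_derived (IH j hs lj')).
  exact: dvalid_comp (dvalid_bump _ _) (dvalid_unbump (leq0n _)).
- have e : ((size s).+1 - j = size s - j.-1)%N by lia.
  rewrite e; apply: dvalid_comp (dvalid_derived (IH j.-1 hs _)); last by lia.
  exact: dvalid_unbump.
have e : ((size s).+1 - j = (size s - j).+1)%N by lia.
by rewrite e; apply/dvalid_derived/IH => //; lia.
Qed.

(* Sz_i x = (tau y)^-1 * s_p (Sz_k (d_0 x)) with p = [tail_index i], the number of
   leading nonzero entries of i, and k = [tail_seq i]. *)
Fixpoint tail_index (s : seq nat) : nat :=
  if s is a.+1 :: t then (tail_index t).+1 else 0.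

Fixpoint tail_seq (s : seq nat) : seq nat :=
  match s with a.+1 :: t => a :: tail_seq t | _ :: t => t | [::] => [::] end.

(** Comparing [j.+1] with a first entry [a.+1] is comparing [j] with [a], so leading nonzero entries
    only derive the statement. At the first zero entry the operator ends with [unbump 0], which
    becomes [unbump (tail_index s)]. *)
Lemma Dmap_tail s j : Sseqb s -> (0 < size s)%N ->
  Dmap s j.+1 =1 Dmap (tail_seq s) j \o unbump (tail_index s).
Proof.
elim: s j => [|[|a] s IH] j // /andP[la hs] _ k.
  by case: k => [|k] /=; rewrite ?Dmap0 // /unbump ?subn1 ?subn0.
have s0 : (0 < size s)%N by apply: leq_trans la.
have e i : derived (Dmap s i.+1) k =
    derived (Dmap (tail_seq s) i) (unbump (tail_index s).+1 k).
  case: k => [|k] //=; rewrite (IH _ hs s0) /=.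
  by rewrite -derived_unbump.
rewrite /= ltnS eqSS subSS; case: ltngtP => [lja|laj|eja] //=.
- by rewrite e.
- by case: j laj => // j _; rewrite /= e.
Qed.

Lemma tail_seqP s : Sseqb s -> (0 < size s)%N ->
  [/\ size (tail_seq s) = (size s).-1, Sseqb (tail_seq s) &
      (tail_index s < size s)%N].
Proof.
elim: s => [|[|a] s IH] //= /andP[la hs] _.
have s0 : (0 < size s)%N by apply: leq_trans la.
have [-> -> lt] := IH hs s0; rewrite andbT; split; lia.
Qed.

Lemma Dmap_zeros k s t : (t <= k)%N -> Dmap (nseq k 0%N ++ s) 0 t = t.
Proof. by elim: k t => [|k IH] [|t] //= lt; rewrite ?Dmap0 ?IH. Qed.

(** A nonzero first entry brings in an [unbump 0] that merges vertices 0 and 1; a zero entry merely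
    derives the operator of the rest. *)
Lemma Dmap_injective_zeros s k : (k <= size s)%N ->
  (forall t, (t < k)%N -> Dmap s 0 t <> Dmap s 0 t.+1) ->
  s = nseq k 0%N ++ drop k s.
Proof.
elim: k s => [|k IH] [|[|a] s] //= lk inj; last by case: (inj 0%N); rewrite //= Dmap0.
by rewrite -IH // => t lt /(congr1 S); apply: (inj t.+1).
Qed.

(** * Lattice paths *)

(* A lattice path from (0, 0) to (n, q), given by its two coordinates. *)
Record lpath n q (a b : nat -> nat) : Prop := LPath {
  lpath_l : dvalid (n + q) n a;
  lpath_r : dvalid (n + q) q b;
  lpathD : forall t, (t <= n + q)%N -> (a t + b t = t)%N }.

Section LatticePath.
Variables (n q : nat) (a b : nat -> nat).
Hypothesis ab : lpath n q a b.

Lemma lpath_l0 : a 0 = 0%N.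
Proof. by move/eqP: (lpathD ab (leq0n _)); rewrite addn_eq0 => /andP[/eqP]. Qed.

Lemma lpath_step t : (t < n + q)%N ->
  a t.+1 = a t /\ b t.+1 = (b t).+1 \/ a t.+1 = (a t).+1 /\ b t.+1 = b t.
Proof.
move=> lt; have [[am _] [bm _] abD] := ab.
have := am t t.+1; have := bm t t.+1; have := abD t; have := abD t.+1.
lia.
Qed.

Lemma lpath_crossing p : (p < n)%N ->
  exists t, [/\ (t < n + q)%N, a t = p, a t.+1 = p.+1 & b t.+1 = b t].
Proof.
move=> pn; have [[am an] [bm bq] abD] := ab.
have: (p < a (n + q))%N.
  by have := abD (n + q)%N (leqnn _); have := bq (n + q)%N (leqnn _); lia.
elim: {1 3}(n + q)%N (leqnn (n + q)%N) => [|t IH] lt pa.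
  by have := abD 0%N isT; lia.
have [pt|le_ap] := ltnP p (a t); first exact: IH (ltnW lt) pt.
by exists t; have := lpath_step lt; split; lia.
Qed.

Lemma lpath_run k : (k <= n)%N ->
  (forall t, (t < k)%N -> a t <> a t.+1) -> forall t, (t <= k)%N -> a t = t.
Proof.
move=> kn inj; elim=> [|t IH] lt; first by rewrite lpath_l0.
have := lpath_step (t := t); have := IH (ltnW lt); have := inj t lt; lia.
Qed.

End LatticePath.

(** After [k] steps the path stands at [(k, 0)], hence only the first coordinate is shifted. *)
Lemma lpath_drop k m q a b : lpath (k + m) q a b -> a k = k ->
  lpath m q (fun t => a (k + t) - k)%N (fun t => b (k + t)%N).
Proof.
move=> [[am an] [bm bq] abD] ak; split.
- split=> [i j|i] lij; last by have := an (k + i)%N; lia.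
  by have := am (k + i)%N (k + j)%N; lia.
- split=> [i j|i] lij; first by have := bm (k + i)%N (k + j)%N; lia.
  by have := bq (k + i)%N; lia.
by move=> t lt; have := abD (k + t)%N; have := am k (k + t)%N; lia.
Qed.

(** * Shuffles as lattice paths *)

Lemma homo_iter_unbump s : {homo iter_unbump s : i j / (i <= j)%N}.
Proof.
move=> i j ij; elim: s => //= m s IH.
by rewrite /unbump; move: IH; case: ltnP; case: ltnP; lia.
Qed.

Lemma iter_unbump_fix s l : all (leq l) s -> iter_unbump s l = l.
Proof. by elim: s => //= m s IH /andP[lm /IH ->]; rewrite /unbump; lia. Qed.

(** The later, larger entries act first and fix everything up to [m.+1]. By monotonicity a value
    above [m] stays above [m], so each entry below [k] lowers it by exactly one. *)
Lemma iter_unbumpD s k : sorted ltn s ->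
  (iter_unbump s k + count (fun m => m < k) s = k)%N.
Proof.
elim: s => [|m s IH] /=; first by rewrite addn0.
rewrite (path_sortedE ltn_trans) => /andP[/iter_unbump_fix fm /IH e].
have := @homo_iter_unbump s m.+1 k.
by rewrite fm /unbump; move: e; case: ltnP; case: ltnP; lia.
Qed.

Lemma sum_ltn_ord N k : (k <= N)%N -> (\sum_(i < N) (i < k) = k)%N.
Proof.
move=> kN; rewrite -[RHS](minn_idPl kN) {kN}.
elim: N => [|N IH]; first by rewrite big_ord0 minn0.
by rewrite big_ord_recr /= IH; lia.
Qed.

Lemma count_map_enum (I : finType) (f : I -> nat) k :
  (count (fun m => m < k) [seq f i | i <- enum I] = \sum_(i : I) (f i < k))%N.
Proof.
rewrite -sum1_count big_map big_mkcond big_enum.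
by apply: eq_bigr => i _; case: ltnP.
Qed.

Section Shuffle.
Variables (p q : nat) (w : 'S_(p + q)).
Hypothesis shw : shuffle w.

Lemma shuffle_lt (i j : 'I_(p + q)) :
  (i < j)%N -> (j < p)%N || (p <= i)%N -> (w i < w j)%N.
Proof.
by move=> ij h; have /forallP/(_ i)/forallP/(_ j) := shw; rewrite ij h.
Qed.

Lemma sorted_map_enum_ord r (f : 'I_r -> nat) :
  (forall i j : 'I_r, (i < j)%N -> (f i < f j)%N) ->
  sorted ltn [seq f i | i <- enum 'I_r].
Proof.
move=> fm; have := iota_ltn_sorted 0 r; rewrite -val_enum_ord !sorted_map.
exact: sub_sorted.
Qed.

Lemma sorted_shuffle_nu : sorted ltn (shuffle_nu w).
Proof.
by apply: sorted_map_enum_ord => i j ij; apply: shuffle_lt; rewrite //= ltn_ord.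
Qed.

Lemma sorted_shuffle_mu : sorted ltn (shuffle_mu w).
Proof.
apply: sorted_map_enum_ord => i j ij; apply: shuffle_lt; rewrite /= ?ltn_add2l //.
by rewrite leq_addr orbT.
Qed.

Lemma count_shuffle k : (k <= p + q)%N ->
  (count (fun m => m < k) (shuffle_nu w) +
   count (fun m => m < k) (shuffle_mu w) = k)%N.
Proof.
move=> kpq; rewrite -[RHS](sum_ltn_ord kpq) (reindex_inj (@perm_inj _ w)) /=.
by rewrite big_split_ord !count_map_enum.
Qed.

(** At [t] the coordinates are [t] minus the number of entries of [mu], respectively [nu], below
    [t]; these two numbers add up to [t]. *)
Lemma shuffle_lpath :
  lpath p q (iter_unbump (shuffle_mu w)) (iter_unbump (shuffle_nu w)).
Proof.
have muE k := iter_unbumpD k sorted_shuffle_mu.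
have nuE k := iter_unbumpD k sorted_shuffle_nu.
have valid s r : all (fun m => m < p + q)%N s -> sorted ltn s ->
    (r + size s = p + q)%N -> dvalid (p + q) r (iter_unbump s).
  rewrite all_count => /eqP sN ss e; split=> [i j /andP[ij _]|i lei].
    exact: homo_iter_unbump.
  have := iter_unbumpD (p + q) ss; have := homo_iter_unbump s lei.
  by rewrite sN; lia.
split.
- apply: valid; first by apply/allP => _ /mapP[i _ ->]; apply: ltn_ord.
    exact: sorted_shuffle_mu.
  by rewrite size_map -cardE card_ord.
- apply: valid; first by apply/allP => _ /mapP[i _ ->]; apply: ltn_ord.
    exact: sorted_shuffle_nu.
  by rewrite size_map -cardE card_ord addnC.
by move=> t /count_shuffle; have := muE t; have := nuE t; lia.
Qed.

(** Both sides of the inequality have the same sum over [i], so every term is an equality. *)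
Lemma perm_ge_eq1 N (u : 'S_N) : (forall i : 'I_N, (i <= u i)%N) -> u = 1%g.
Proof.
move=> iu; have [_] := leqif_sum (fun i _ => leqif_geq (iu i)) (P := predT).
rewrite [X in (_ == X)](_ : _ = \sum_(i < N) i)%N; last first.
  by rewrite [RHS](reindex_inj (@perm_inj _ u)).
rewrite eqxx => /esym/forallP ui; apply/permP => i; rewrite perm1; apply/val_inj/eqP.
by rewrite eqn_leq iu andbT; apply: ui.
Qed.

(** The hypothesis says that no entry of [mu] is below [p]. As [w] increases on both blocks, this
    gives [i <= w i] throughout. *)
Lemma shuffle_eq1 : iter_unbump (shuffle_mu w) p = p -> w = 1%g.
Proof.
move=> fp; have := iter_unbumpD p sorted_shuffle_mu; rewrite fp => c0.
have mup (j : 'I_q) : (p <= w (rshift p j))%N.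
  rewrite leqNgt; apply/negP => lt.
  suff: has (fun m => m < p)%N (shuffle_mu w) by rewrite has_count; lia.
  apply/hasP; exists (val (w (rshift p j))) => //.
  by apply/mapP; exists j; rewrite ?mem_enum.
apply: perm_ge_eq1 => -[i lti] /=.
elim: i lti => [|i IH] lti //.
have lti' := ltnW lti; have := IH lti'.
have := @shuffle_lt (Ordinal lti') (Ordinal lti) (ltnSn i) => /=.
case: (ltngtP i.+1 p) => [ip|pi|eip].
- by move=> /(_ isT) /=; lia.
- by rewrite -ltnS pi /= => /(_ isT); lia.
(* Between the two blocks [w] need not increase; there the bound on [mu] takes over. *)
have := mup; move: lti; rewrite eip => lti.
have q0 : (0 < q)%N by lia.
move=> /(_ (Ordinal q0)) h _ _; apply: leq_trans h _.
rewrite leq_eqVlt; apply/orP; left.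
by apply/eqP; congr (val (w _)); apply/val_inj; rewrite /= addn0.
Qed.

End Shuffle.

Lemma shuffle1 p q : shuffle (1%g : 'S_(p + q)).
Proof.
apply/forallP => i; apply/forallP => j; apply/implyP => /andP[ij _].
by rewrite !perm1.
Qed.

Lemma iter_unbump_shuffle_mu1 p q :
  iter_unbump (shuffle_mu (1%g : 'S_(p + q))) p = p.
Proof.
by apply/iter_unbump_fix/allP => _ /mapP[i _ ->]; rewrite perm1 /= leq_addr.
Qed.

(** * Operators on the loop group and Szczarba simplices *)

Lemma iter_bump0 k t : iter k (bump 0) t = (k + t)%N.
Proof. by elim: k => //= k ->. Qed.

Lemma iter_bump1 k t : iter k (bump 1) t = if t is u.+1 then (k + u).+1 else 0%N.
Proof. by elim: k => [|k /= ->]; case: t. Qed.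

Section KanPull.
Variable X : sset.

(** The result type is [loop X m], so that the group operations apply to it directly. *)
Definition kpull m n f (g : loop X n) : loop X m := pull (X := kan X) m f g.
Arguments kpull m {n} f g.

Lemma eq_kpull m n f f' (g : loop X n) :
  (forall t, t <= m -> f t = f' t)%N -> kpull m f g = kpull m f' g.
Proof. exact: (@eq_pull (kan X)). Qed.

Lemma kpull_id n (g : loop X n) : kpull n id g = g.
Proof. exact: (@pull_id (kan X)). Qed.

Lemma kpull_comp l m n f f' (g : loop X n) :
  dvalid m n f -> dvalid l m f' -> kpull l f' (kpull m f g) = kpull l (f \o f') g.
Proof. exact: (@pull_comp (kan X)). Qed.

Lemma kpullM m n f (g h : loop X n) :
  kpull m f (g * h)%g = (kpull m f g * kpull m f h)%g.
Proof. exact: kan_pullM. Qed.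

Lemma kpull1 m n f : kpull m f (1%g : loop X n) = 1%g.
Proof. exact: loop_act1. Qed.

Lemma kpullV m n f (g : loop X n) : kpull m f (g^-1)%g = ((kpull m f g)^-1)%g.
Proof. exact: loop_actV. Qed.

Lemma kpull_tau m n f (x : X n.+1) : dvalid m n f ->
  kpull m f (tau x) =
  ((tau (pull m.+1 (fun k => if k is l.+1 then (f l).+1 else 1%N) x))^-1 *
    tau (pull m.+1 (derived f) x))%g.
Proof. exact: kan_pull_tau. Qed.

Lemma kpull_tau0 m n f (x : X n.+1) : dvalid m n f -> f 0 = 0%N ->
  kpull m f (tau x) = tau (pull m.+1 (derived f) x).
Proof.
move=> vf f0; rewrite kpull_tau // tau_eq1 ?invg1 ?mul1g //=; last by rewrite f0.
have [fm fn] := vf; split=> [[|i] [|j] //|[|i] //]; last exact: fn.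
by rewrite !ltnS => /fm.
Qed.

Definition Sz_tail n (i : seq nat) (x : X n.+1) : loop X n :=
  (\prod_(j < n) (kpull n (Dmap i j.+1)
    (tau (pull (n - j.+1).+1 (iter j.+1 (bump 0)) x)))^-1)%g.

Lemma SzE n i (x : X n.+1) :
  Sz i x = (\prod_(j < n.+1)
    (kpull n (Dmap i j) (tau (pull (n - j).+1 (iter j (bump 0)) x)))^-1)%g.
Proof. by []. Qed.

Lemma Sz_recl n i (x : X n.+1) : size i = n -> Sseqb i ->
  Sz i x = ((tau (pull n.+1 (derived (Dmap i 0)) x))^-1 * Sz_tail i x)%g.
Proof.
move=> si vi; rewrite SzE big_ord_recl; congr (_^-1 * _)%g.
have vD : dvalid n (n - 0) (Dmap i 0) by rewrite -{1 2}si; apply: dvalid_Dmap.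
rewrite [LHS](kpull_tau0 _ vD) ?Dmap0 //.
by move: vD; rewrite subn0 => vD; rewrite pull_id.
Qed.

(** By [Dmap_tail] all factors carry the same degeneracy, which leaves the product because it is a
    group homomorphism. *)
Lemma Sz_tail_sdeg n i (x : X n.+2) : size i = n.+1 -> Sseqb i ->
  Sz_tail i x = kpull n.+1 (unbump (tail_index i)) (Sz (tail_seq i) (dface 0 x)).
Proof.
move=> si vi; have i0 : (0 < size i)%N by rewrite si.
have [st vt] := tail_seqP vi i0; rewrite si /= ltnS => lt.
rewrite SzE (big_morph (kpull n.+1 _) (kpullM n.+1 _) (kpull1 _ _ _)).
apply: eq_bigr => j _; rewrite kpullV; congr (_^-1)%g.
have jn : (j <= n)%N by rewrite -ltnS.
have vD : dvalid n (n - j) (Dmap (tail_seq i) j).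
  by rewrite si /= in st; rewrite -{1 2}st; apply: dvalid_Dmap; rewrite // st.
rewrite [RHS](kpull_comp _ vD (dvalid_unbump lt)).
rewrite /dface pull_comp; last 2 first.
- exact: dvalid_bump.
- by split=> [k l|k]; rewrite !iter_bump0; lia.
apply: eq_kpull => t _.
exact: Dmap_tail.
Qed.

(* [pull m.+1 (vert1 k) x] is x_(1,k+1,...,k+m+1). *)
Definition vert1 (k t : nat) : nat := if t is u.+1 then (k + u).+1 else 1.

Lemma dvalid_addn k m : dvalid m (k + m) (addn k).
Proof. by split=> [i j|i]; lia. Qed.

Lemma dvalid_vert1 k m : dvalid m.+1 (k + m).+1 (vert1 k).
Proof. by split=> [[|i] [|j]|[|i]] //=; lia. Qed.

(** Each leading zero makes the tail an [s_0] of a Szczarba simplex of [dface 0 x], and [addn k.+1]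
    absorbs that [s_0]. Under [addn k] the leading factor of this simplex splits in two: one part
    cancels the given [tau], the other is the [tau] of the induction hypothesis. *)
Lemma Sz_tail_zeros k m j (x : X (k + m).+1) : size j = m -> Sseqb j ->
  (tau (pull m.+1 (vert1 k) (pull (k + m).+1 (derived (Dmap (nseq k 0%N ++ j) 0)) x)) *
   kpull m (addn k) (Sz_tail (nseq k 0%N ++ j) x))%g =
  Sz_tail j (pull m.+1 (addn k) x).
Proof.
move=> sj vj; elim: k x => [|k IH] x.
  rewrite tau_eq1 //; last exact: dvalid_vert1.
  rewrite mul1g [LHS](@eq_kpull _ _ _ id) // kpull_id.
  by rewrite (@eq_pull _ _ _ _ id) // pull_id.
set i := nseq k 0%N ++ j.
have si : size i = (k + m)%N by rewrite size_cat size_nseq sj.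
have vi : Sseqb i by rewrite /i; elim: (k) => //=.
have vi0 : Sseqb (0%N :: i) by [].
have vD : dvalid (k + m) (k + m) (Dmap i 0).
  by rewrite -{1 2}si -{2}(subn0 (size i)); apply: dvalid_Dmap.
have va : dvalid m (k + m) (addn k) := dvalid_addn k m.
have va1 : dvalid m.+1 (k + m).+1 (addn k) by rewrite -addnS; apply: dvalid_addn.
have v1 := dvalid_vert1 k m.
rewrite (_ : nseq k.+1 0%N ++ j = 0%N :: i) // Sz_tail_sdeg //; last by rewrite /= si.
rewrite [tail_index _]/= [tail_seq _]/= [Dmap (_ :: _) 0]/(derived (Dmap i 0)).
rewrite [X in (_ * X)%g]kpull_comp; last 2 first.
- exact: dvalid_unbump.
- exact: dvalid_addn k.+1 m.
rewrite [X in (_ * X)%g](@eq_kpull _ _ _ (addn k)); last first.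
  by move=> t _; rewrite /= /unbump; lia.
have -> : pull m.+1 (addn k.+1) x = pull m.+1 (addn k) (dface 0 x).
  rewrite /dface pull_comp //; exact: dvalid_bump.
rewrite -IH -/i Sz_recl //.
set y' := pull _ _ (dface 0 x).
rewrite kpullM kpullV kpull_tau // invgM invgK -mulgA.
(* Vertex 1 of [x] is vertex 0 of [dface 0 x], and the operator fixes it. *)
have -> : pull m.+1 (vert1 k.+1) (pull (k + m).+2 (derived (derived (Dmap i 0))) x) =
    pull m.+1 (derived (addn k)) y'.
  have vdD := dvalid_derived vD.
  rewrite /y' /dface (pull_comp _ (dvalid_bump _ 0) vdD).
  rewrite (pull_comp _ (dvalid_comp (dvalid_bump _ 0) vdD) (dvalid_derived va)).
  rewrite (pull_comp _ (dvalid_derived vdD) (dvalid_vert1 k.+1 m)).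
  by apply: eq_pull => -[|t] _ //=; rewrite Dmap0.
by rewrite mulVKg.
Qed.
End KanPull.
Arguments kpull {X} m {n} f g.

(** * Vanishing of degenerate simplices *)

Section Degenerate.
Variable X : sset.

(** The map [f] factors through the codegeneracy hitting [t] twice, with [bump t] as section. It
    serves for both [X] and [kan X]. *)
Lemma pull_flat (Y : sset) m n f (x : Y n) t : dvalid m.+1 n f ->
  (t <= m)%N -> f t = f t.+1 ->
  pull m.+1 f x = sdeg t (pull m (f \o bump t) x).
Proof.
move=> vf tm ft; rewrite /sdeg pull_comp; last exact: dvalid_unbump.
- apply: eq_pull => u _ /=; rewrite /bump /unbump.
  case: (ltngtP t u) => [tu|ut|<-] /=.
  + by rewrite subn1 (_ : (t <= u.-1)%N) ?add1n ?prednK //; lia.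
  + by rewrite subn0 leqNgt ut.
  by rewrite subn0 leqnn.
exact: dvalid_comp vf (dvalid_bump _ _).
Qed.

Lemma cos_flat m n f (x : X n) t : dvalid m.+1 n f -> (t <= m)%N ->
  f t = f t.+1 -> cos (pull m.+1 f x) = 0.
Proof.
move=> vf tm ft; apply: cos_deg; rewrite (pull_flat x vf tm ft) /=.
by exists t, (pull m (f \o bump t) x).
Qed.

Lemma chain_sdeg n t (g : loop X n) : (t <= n)%N ->
  chain (kpull n.+1 (unbump t) g) = 0.
Proof.
move=> tn; rewrite /chain insubF //; apply/asboolP; apply.
by exists t, g.
Qed.

(** At the step [t] where [a] passes from [p] to [p.+1], [unbump p] merges the two values and [b]
    stands still. Both factors are therefore in the image of [s_t], and so is their product. *)
Lemma chain_shuffle_deg n q a b p (u : loop X n) (h : loop X q) :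
  lpath n.+1 q a b -> (p <= n)%N ->
  chain (kpull (n.+1 + q) a (kpull n.+1 (unbump p) u) * kpull (n.+1 + q) b h)%g = 0.
Proof.
move=> ab pn; have [t [lt at0 at1 bt]] := lpath_crossing ab (p := p) pn.
have [va vb _] := ab; have vp := dvalid_unbump pn.
have tnq : (t <= n + q)%N by [].
rewrite (kpull_comp u vp va).
rewrite {1}/kpull (@pull_flat (kan X) _ _ _ _ t (dvalid_comp vp va)) //; last first.
  by rewrite /= at0 at1 /unbump; lia.
rewrite {1}/kpull [X in (_ * X)%g](@pull_flat (kan X) _ _ _ _ t vb) //.
rewrite -[LHS]/(chain (kpull _ _ _ * kpull _ _ _)%g).
by rewrite -kpullM chain_sdeg.
Qed.

End Degenerate.

(** * The recursion at the inverse of a generator *)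

(** Applying [d_0^k] to [tau Y] gives two factors; the inverse of the second cancels the [tau] of
    [d_1^k Y]. *)
Lemma kpull_tauV_addn (X : sset) k N (Y : X N.+1) (g : loop X N) : (k <= N)%N ->
  (tau (pull (N - k).+1 (iter k (bump 1)) Y) *
   kpull (N - k) (iter k (bump 0)) ((tau Y)^-1 * g))%g =
  (tau (pull (N - k).+1 (vert1 k) Y) * kpull (N - k) (addn k) g)%g.
Proof.
move=> kN; have vk : dvalid (N - k) N (addn k).
  by have := dvalid_addn k (N - k); rewrite subnKC.
rewrite (@eq_kpull _ _ _ (iter k (bump 0)) (addn k)); last first.
  by move=> t _; rewrite iter_bump0.
rewrite kpullM kpullV kpull_tau // invgM invgK -mulgA.
rewrite (@eq_pull _ _ _ (iter k (bump 1)) (derived (addn k))) ?mulVKg //.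
by move=> t _; rewrite iter_bump1; case: t.
Qed.

Section Retraction.
Variables (X : sset) (psi : {additive CG X -> cobar X}).
Hypothesis hpsi : retraction_map psi.

Lemma retraction_tauV N (Y : X N.+1) (g : loop X N) :
  psi (chain ((tau Y)^-1 * g)%g) = psi (chain g) +
    \sum_(k < N.+1) cos (pull k.+1 id Y) *
      psi (chain (tau (pull (N - k).+1 (vert1 k) Y) * kpull (N - k) (addn k) g)%g).
Proof.
have := retraction_rec hpsi Y ((tau Y)^-1 * g)%g; rewrite mulVKg => ->.
rewrite -addrA -sumrN -big_split big1 ?addr0 //= => k _.
apply/eqP; rewrite addrC subr_eq0; apply/eqP.
have kN : (k <= N)%N by rewrite -ltnS.
exact: (congr1 (fun z => _ * psi (chain z)) (esym (kpull_tauV_addn Y g kN))).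
Qed.

End Retraction.

(** * The retraction on a single shuffle *)

(** A composite that moves at each of the first [k] steps forces [a] to move as well, so [a] is the
    identity up to [k]. This is impossible beyond [n], and the rest is [Dmap_injective_zeros]. *)
Lemma Dmap_lpath_injective n q a b s k : lpath n q a b -> size s = n ->
  (k <= n + q)%N ->
  (forall t, (t < k)%N -> Dmap s 0 (a t) <> Dmap s 0 (a t.+1)) ->
  [/\ (k <= n)%N, s = nseq k 0%N ++ drop k s & a k = k].
Proof.
move=> ab ss kN inj.
have ainj t : (t < k)%N -> a t <> a t.+1 by move=> /inj + e; rewrite e.
have kn : (k <= n)%N.
  rewrite leqNgt; apply/negP => nk.
  have an := lpath_run ab (leqnn n) (fun t tn => ainj t (ltn_trans tn nk)) (leqnn n).
  have [[am ale] _ _] := ab; have := ainj n nk.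
  by have := am n n.+1; have := ale n.+1; lia.
have ar := lpath_run ab kn ainj; split=> //; last exact: ar.
apply: Dmap_injective_zeros; first by rewrite ss.
by move=> t tk; have := inj t tk; rewrite !ar // ltnW.
Qed.

Section RetractionSz.
Variables (X : sset) (psi : {additive CG X -> cobar X}).
Hypothesis hpsi : retraction_map psi.

(** The equality of dimensions is a hypothesis, which avoids a cast between [X k.+1] and
    [X n.+1]. *)
Lemma cos_pull_id k n f (x : X n.+1) : k = n ->
  (forall t, (t <= k.+1)%N -> f t = t) -> cos (pull k.+1 f x) = cos x.
Proof.
by move=> ekn; rewrite {}ekn => ft; rewrite (@eq_pull _ _ _ _ id) // pull_id.
Qed.

Lemma chain_kpull_id m n f (h : loop X n) : m = n ->
  (forall t, (t <= m)%N -> f t = t) -> chain (kpull m f h) = chain h.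
Proof.
by move=> emn; subst m => ft; rewrite (@eq_kpull _ _ _ _ id) // kpull_id.
Qed.

Lemma Sz_tail0 n i (x : X n.+1) : n = 0%N -> Sz_tail i x = 1%g.
Proof. by move=> n0; subst n; rewrite /Sz_tail big_ord0. Qed.

Lemma chain_Sz_tail n q i (x : X n.+1) a b (h : loop X q) :
  lpath n q a b -> (0 < n)%N -> size i = n -> Sseqb i ->
  chain (kpull (n + q) a (Sz_tail i x) * kpull (n + q) b h)%g = 0.
Proof.
case: n x => // n x ab _ si vi; have i0 : (0 < size i)%N by rewrite si.
have [_ _] := tail_seqP vi i0; rewrite {1}si ltnS => lt.
by rewrite Sz_tail_sdeg //; apply: chain_shuffle_deg.
Qed.

Lemma retraction_Sz_term n q i (x : X n.+1) a b (h : loop X q) k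
    (Y := pull (n + q).+1 (derived a) (pull n.+1 (derived (Dmap i 0)) x))
    (g := (kpull (n + q) a (Sz_tail i x) * kpull (n + q) b h)%g) :
  size i = n -> Sseqb i -> lpath n q a b -> (k <= n + q)%N ->
  cos (pull k.+1 id Y) *
    psi (chain (tau (pull (n + q - k).+1 (vert1 k) Y) *
                kpull (n + q - k) (addn k) g)%g) =
  if [&& k == n, i == nseq n 0%N & a n == n] then cos x * psi (chain h) else 0.
Proof.
move=> si vi ab kN.
have vD : dvalid n n (Dmap i 0).
  by rewrite -{1 2}si -{2}(subn0 (size i)); apply: dvalid_Dmap.
have [va vb abD] := ab.
have vk : dvalid k.+1 (n + q).+1 id by split=> [t u|t]; lia.
have vda := dvalid_derived va; have vdD := dvalid_derived vD.
have -> : pull k.+1 id Y = pull k.+1 (derived (Dmap i 0) \o derived a) x.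
  by rewrite /Y (pull_comp _ vdD vda) (pull_comp _ (dvalid_comp vdD vda) vk).
have vc : dvalid k.+1 n.+1 (derived (Dmap i 0) \o derived a) :=
  dvalid_comp (dvalid_comp vdD vda) vk.
have a0 := lpath_l0 ab.
case: (pselect (exists2 t, (t < k)%N & Dmap i 0 (a t) = Dmap i 0 (a t.+1))).
  move=> [t tk et]; rewrite (@cos_flat _ _ _ _ _ t.+1) //=; last by rewrite et.
  (* The nonzero case cannot occur here: it would make the composite the identity on [0..n], against
     the repeated value. *)
  rewrite mul0r; case: and3P => // -[/eqP ek /eqP ei /eqP an].
  have le u : (u <= n)%N -> Dmap i 0 (a u) = u.
    move=> un; have -> : a u = u.
      have := abD u; have := abD n; have [[am _] [bm _] _] := ab.
      by have := am u n; have := bm u n; lia.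
    by rewrite ei -[nseq _ _]cats0 Dmap_zeros.
  by move: et; rewrite !le //; lia.
move=> noflat.
have inj t : (t < k)%N -> Dmap i 0 (a t) <> Dmap i 0 (a t.+1).
  by move=> tk et; apply: noflat; exists t.
have [kn ei ak] := Dmap_lpath_injective ab si kN inj.
rewrite /g /Y {g Y vk vc noflat inj}.
(* Replacing [n] by [k + m] removes the subtraction from the dimensions. *)
have [m en] : exists m, n = (k + m)%N by exists (n - k)%N; rewrite subnKC.
set j := drop k i in ei; have sj : size j = m by rewrite size_drop si en addKn.
clear si; subst n.
have vj : Sseqb j by move: vi; rewrite ei; elim: (k).
rewrite (_ : k + m + q - k = m + q)%N; last by rewrite -addnA addKn.
have vk : dvalid (m + q) (k + m + q) (addn k) by rewrite -addnA; apply: dvalid_addn.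
have v1 : dvalid (m + q).+1 (k + m + q).+1 (vert1 k).
  by rewrite -addnA; apply: dvalid_vert1.
have abk := lpath_drop ab ak; have [va' vb' _] := abk.
set a' := (fun t => a (k + t) - k)%N in abk va'.
set b' := (fun t => b (k + t)%N) in abk vb'.
have ale t : (t <= m + q)%N -> (k <= a (k + t))%N.
  by move=> tN; have := va.1 k (k + t)%N; lia.
rewrite (pull_comp _ vda v1).
(* The remaining path [a'] can be applied after the operator, which puts [tau] and the tail under
   one common [kpull]. *)
rewrite (@eq_pull _ _ _ (derived a \o vert1 k) (vert1 k \o derived a')); last first.
  move=> [|t] tN; first by rewrite /= a0.
  by rewrite /= subnKC // ale.
rewrite -(pull_comp _ (dvalid_vert1 k m) (dvalid_derived va')).
rewrite -(kpull_tau0 _ va'); last by rewrite /a' addn0 ak subnn.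
rewrite kpullM (kpull_comp _ va vk) (kpull_comp _ vb vk).
rewrite [kpull _ (a \o _) _](@eq_kpull _ _ _ _ (addn k \o a')); last first.
  by move=> t tN; rewrite /= /a' subnKC // ale.
rewrite -(kpull_comp _ (dvalid_addn k m) va') mulgA -kpullM.
rewrite ei Sz_tail_zeros // -ei.
have -> : [&& k == k + m, i == nseq (k + m) 0%N & a (k + m) == k + m]%N = (m == 0%N).
  apply/and3P/eqP => [[/eqP ekm _ _]|m0]; first by lia.
  split; rewrite ?m0 ?addn0 ?ak //.
  rewrite {1}ei -[nseq k 0%N in X in _ == X]cats0; apply/eqP.
  by congr cat; apply: size0nil; rewrite sj.
(* For [m > 0] the tail left over is degenerate; for [m = 0] it is an empty product and [b'] is the
   identity. *)
have [m0|m_gt0] := posnP m; last by rewrite (chain_Sz_tail _ _ abk) // raddf0 mulr0.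
have b'_id t : (t <= m + q)%N -> b' t = t.
  move=> tq.
  by have := abk.(lpathD) tq; have := va'.2 t tq; lia.
have emq : (m + q = q)%N by rewrite m0.
rewrite Sz_tail0 // kpull1 mul1g (chain_kpull_id h emq b'_id).
congr (_ * _); apply: cos_pull_id => [|[|t] //= tk]; first by rewrite m0 addn0.
rewrite (_ : a t = t) ?ei ?Dmap_zeros //.
have := abD t; have := abD k; have [[am _] [bm _] _] := ab.
by have := am t k; have := bm t k; lia.
Qed.

(** The first summand is the term outside the sum in the recursion. It survives only for [n = 0],
    where it will cancel the [-1] in the value of the Szczarba map on [cos x]. *)
Lemma retraction_Sz_shuffle n q i (x : X n.+1) a b (h : loop X q) :
  size i = n -> Sseqb i -> lpath n q a b ->
  psi (chain (kpull (n + q) a (Sz i x) * kpull (n + q) b h)%g) =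
  (if n == 0%N then psi (chain h) else 0) +
  (if (i == nseq n 0%N) && (a n == n) then cos x * psi (chain h) else 0).
Proof.
move=> si vi ab; have [va vb abD] := ab.
have a0 := lpath_l0 ab.
rewrite Sz_recl // kpullM kpullV (kpull_tau0 _ va a0) -mulgA retraction_tauV //.
congr (_ + _).
  have [n0|n_gt0] := posnP n; last by rewrite (chain_Sz_tail _ _ ab) // raddf0.
  rewrite Sz_tail0 // kpull1 mul1g (@chain_kpull_id _ _ _ h) ?n0 // => t tq.
  by have := abD t; have := va.2 t; rewrite n0; lia.
have nN : (n < (n + q).+1)%N by rewrite ltnS leq_addr.
rewrite (bigD1 (Ordinal nN)) //= big1 ?addr0 => [|k kn]; last first.
  have kN : (k <= n + q)%N by rewrite -ltnS.
  rewrite retraction_Sz_term //; case: and3P => // -[/eqP ek _ _].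
  by case/eqP: kn; apply: val_inj.
by rewrite retraction_Sz_term ?eqxx ?leq_addr.
Qed.

End RetractionSz.

(** * The product on the chains of the loop group *)

Section Multiplication.
Variable X : sset.

Lemma shuffle_mulE p q (g : loop X p) (h : loop X q) :
  shuffle_mul g h = \sum_(w : 'S_(p + q) | shuffle w) (-1 : int) ^+ w *:
    chain (kpull (p + q) (iter_unbump (shuffle_mu w)) g *
           kpull (p + q) (iter_unbump (shuffle_nu w)) h)%g.
Proof. by []. Qed.

Lemma shuffle_mul_deg p q (g : loop X p) (h : loop X q) :
  degenerate (X := kan X) g -> shuffle_mul g h = 0.
Proof.
case: p g => // p g [i [u [ip ->]]]; apply: big1 => w shw.
by rewrite (chain_shuffle_deg u h (shuffle_lpath shw) ip) scaler0.
Qed.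

HB.instance Definition _ (f : ndloop X -> CG X) :=
  GRing.isAdditive.Build (CG X) (CG X) (fglift f) (lift_is_additive f).

Lemma mulCGBl (c c' d : CG X) : mulCG (c - c') d = mulCG c d - mulCG c' d.
Proof. exact: raddfB. Qed.

Lemma mulCG_suml (I : Type) (r : seq I) (e : I -> nat) (c : I -> CG X) d :
  mulCG (\sum_(i <- r) (-1 : int) ^+ e i *: c i) d =
  \sum_(i <- r) (-1 : int) ^+ e i *: mulCG (c i) d.
Proof. by rewrite /mulCG raddf_sum; apply: eq_bigr => i _; rewrite raddfZsign. Qed.

(** For degenerate [g] both sides vanish, by [shuffle_mul_deg]. *)
Lemma mulCG_chain n (g : loop X n) (s : ndloop X) :
  mulCG (chain g) << s >> = shuffle_mul g (tagged (val s)).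
Proof.
rewrite /chain; case: insubP => [t _ et|].
  by rewrite /mulCG !liftU !scale1r et.
by move/asboolPn/contrapT => dg; rewrite shuffle_mul_deg // /mulCG raddf0.
Qed.

Lemma chain_val (s : ndloop X) : chain (tagged (val s)) = << s >>.
Proof. by rewrite /chain (_ : Tagged _ _ = val s) ?valK //; case: (val s). Qed.

Lemma fgliftE (f : ndloop X -> CG X) c :
  fglift f c = \sum_(s <- dom c) coeff s c *: f s.
Proof.
rewrite -{1}[c]freeg_sumE raddf_sum /=.
by apply: eq_bigr => s _; rewrite liftU.
Qed.

Lemma mulCG_is_additive (c : CG X) : additive (@mulCG X c).
Proof.
move=> d d'; rewrite /mulCG !fgliftE -sumrB; apply: eq_bigr => s _.
by rewrite raddfB scalerBr.
Qed.

HB.instance Definition _ (c : CG X) :=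
  GRing.isAdditive.Build (CG X) (CG X) (@mulCG X c) (mulCG_is_additive c).

(** For [p = 0] every path satisfies the criterion of [shuffle_eq1], since it starts at 0. *)
Lemma shuffle_mul1 q (h : loop X q) : shuffle_mul (1%g : loop X 0) h = chain h.
Proof.
rewrite shuffle_mulE (bigD1 (1%g : 'S_(0 + q))) ?shuffle1 //=.
rewrite big1 ?addr0 => [|w /andP[shw /eqP[]]].
  rewrite odd_perm1 expr0 scale1r kpull1 mul1g chain_kpull_id // => t tq.
  have ab := shuffle_lpath (shuffle1 0 q).
  by have := lpathD ab tq; have := (lpath_l ab).2 t tq; lia.
by apply/shuffle_eq1/lpath_l0/shuffle_lpath.
Qed.

Lemma eq_additive_CG (U : zmodType) (f f' : {additive CG X -> U}) :
  (forall s : ndloop X, f << s >> = f' << s >>) -> f =1 f'.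
Proof.
move=> ff' c; rewrite -[c]freeg_sumE !raddf_sum; apply: eq_bigr => s _.
by rewrite -[coeff s c]intz -freegU_mulz !raddfMz ff'.
Qed.

End Multiplication.

(** * The composite on generators and on products *)

Section Retract.
Variables (X : sset) (phi : {additive cobar X -> CG X}).
Variable psi : {additive CG X -> cobar X}.
Hypotheses (hphi : szczarba_map phi) (hpsi : retraction_map psi).

Lemma retraction_shuffle_mul n q i (x : X n.+1) (h : loop X q) :
  size i = n -> Sseqb i ->
  psi (shuffle_mul (Sz i x) h) =
  (if n == 0%N then psi (chain h) else 0) +
  (if i == nseq n 0%N then cos x * psi (chain h) else 0).
Proof.
move=> si vi; rewrite shuffle_mulE (bigD1 (1%g : 'S_(n + q))) ?shuffle1 //= raddfD.
rewrite odd_perm1 expr0 scale1r.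
rewrite (retraction_Sz_shuffle hpsi) //; last exact/shuffle_lpath/shuffle1.
rewrite iter_unbump_shuffle_mu1 eqxx andbT raddf_sum big1 ?addr0 // => w /andP[shw w1].
have an : iter_unbump (shuffle_mu w) n != n by apply: contra_neq w1; apply: shuffle_eq1.
(* For [n = 0] there is no nontrivial shuffle, so the extra summand does not arise again. *)
have n0 : n != 0%N.
  by have := (lpath_l (shuffle_lpath shw)).2 n (leq_addr _ _); lia.
rewrite scaler_sign.
have e := retraction_Sz_shuffle hpsi x h si vi (shuffle_lpath shw).
rewrite (negPf n0) (negPf an) andbF addr0 in e.
by case: (odd_perm w); rewrite ?raddfN /= e ?oppr0.
Qed.

Lemma retraction_szczarba_cos_chain n (x : X n.+1) (s : ndloop X) :
  ~ degenerate x ->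
  psi (mulCG (phi (cos x)) << s >>) = cos x * psi << s >>.
Proof.
case: n x => [|n] x ndx.
  rewrite (szczarba_s1 hphi) // mulCGBl !mulCG_chain raddfB shuffle_mul1 chain_val.
  have -> : (tau x)^-1%g = Sz [::] x.
    rewrite Sz_recl // Sz_tail0 // mulg1 (@eq_pull _ _ _ _ id) ?pull_id //.
    by case.
  by rewrite retraction_shuffle_mul // eqxx chain_val addrAC subrr add0r.
rewrite (szczarba_s hphi) // mulCG_suml raddf_sum.
have term i : i \in Sseq n.+1 ->
    psi ((-1 : int) ^+ sumn i *: mulCG (chain (Sz i x)) << s >>) =
    if i == nseq n.+1 0%N then cos x * psi << s >> else 0.
  rewrite mem_SseqE => /andP[/eqP si vi].
  rewrite -signr_odd scaler_sign mulCG_chain -chain_val.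
  have e := retraction_shuffle_mul x (tagged (val s)) si vi; rewrite add0r in e.
  (* The zero sequence has sum 0, so its sign is [+1]. *)
  case: eqP e => [->|_] e; first by rewrite sumn_nseq.
  by case: odd; rewrite ?raddfN /= e ?oppr0.
have z0 : nseq n.+1 0%N \in Sseq n.+1.
  by rewrite mem_SseqE size_nseq eqxx; elim: n.+1.
have := uniq_Sseq n.+1.
move: (nseq _ _) (Sseq _) term z0 => z r term zr ur.
rewrite (bigD1_seq z) // big_seq_cond big1 => [|i /andP[/term -> /negPf ->]] //.
by rewrite (term _ zr) eqxx /= addr0.
Qed.

Lemma retraction_szczarba_cos n (x : X n.+1) c :
  psi (mulCG (phi (cos x)) c) = cos x * psi c.
Proof.
have [dx|ndx] := pselect (degenerate x).
  by rewrite cos_deg // raddf0 mul0r /mulCG raddf0 raddf0.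
apply: (@eq_additive_CG _ _ (psi \o mulCG (phi (cos x))) (cos x \*o psi)) => s.
exact: retraction_szczarba_cos_chain.
Qed.

Lemma retraction_szczarbaM a b : psi (phi (a * b)) = a * psi (phi b).
Proof.
elim/cobar_ind: a b => [|n x _|x _|a a' IHa IHa'|a a' IHa IHa'] b.
- by rewrite !mul1r.
- by rewrite (szczarba_mul hphi) retraction_szczarba_cos.
(* The left side collapses to [psi (phi b)]; multiplying by [coxi x] from the left then isolates
   [psi (phi (coxi x * b))]. *)
- have e : psi (phi ((1 + cos x) * (coxi x * b))) =
      (1 + cos x) * psi (phi (coxi x * b)).
    rewrite !mulrDl !mul1r !raddfD /=.
    by rewrite [phi (cos x * _)](szczarba_mul hphi) retraction_szczarba_cos.
  by rewrite mulrA mul_coxi mul1r in e; rewrite e mulrA coxi_mul mul1r.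
- by rewrite !mulrBl !raddfB /= IHa IHa'.
by rewrite -!mulrA IHa IHa'.
Qed.

End Retract.

Theorem proposition14 (X : sset) (hX : reduced0 X)
  (phi : {additive cobar X -> CG X}) (hphi : szczarba_map phi)
  (psi : {additive CG X -> cobar X}) (hpsi : retraction_map psi) :
  forall a : cobar X, psi (phi a) = a.
Proof.
move=> a; rewrite -[a in LHS]mulr1 (retraction_szczarbaM hphi hpsi).
by rewrite (szczarba_one hphi) (retraction_one hpsi) mulr1.
Qed.
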